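(* For an elasticity tensor $E=(\lambda,\mu,d',v',H)\in\mathbb{E}\mathrm{la}$ consider the following 21 polynomial invariants: $\lambda=\operatorname{tr} d$, $\mu=\operatorname{tr} v$, $$I_2:=\operatorname{tr} d_2,\quad I_3:=\operatorname{tr} d_3,\quad I_4:=\operatorname{tr} d_2^2,\quad I_5:=\operatorname{tr}(d_2d_3),\quad I_6:=\operatorname{tr} d_2^3,$$ $$I_7:=\operatorname{tr}(d_2^2d_3),\quad I_8:=\operatorname{tr}(d_2d_3^2),\quad I_9:=\operatorname{tr} d_3^3,\quad I_{10}:=\operatorname{tr}(d_2^2d_3^2),$$ $$D_3:=d':d_2,\quad D_4:=d':d_3,\quad D_5:=d':d_2^2,\quad D_6:=d':(d_2d_3+d_3d_2),\quad D_{11}:=d':[d_2,d_3]^2,$$ $$V_3:=v':d_2,\quad V_4:=v':d_3,\quad V_5:=v':d_2^2,\quad V_6:=v':(d_2d_3+d_3d_2),\quad V_{11}:=v':[d_2,d_3]^2.$$ These 21 invariants separate generic elasticity tensors, namely those satisfying: (1) the pair $(d_2,d_3)$ is triclinic, and (2) $d_2$ is orthotropic. That is, if $E$ and $\overline{E}$ are two elasticity tensors both satisfying (1) and (2), and if each of the 21 invariants takes the same value on $E$ and on $\overline{E}$, then there exists $g\in\mathrm{O}(3)$ such that $\overline{E}=g\star E$.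
   Context: All tensors are real tensors on $\mathbb{R}^3$ with components in an orthonormal basis; repeated indices are summed. $\mathbb{E}\mathrm{la}$ is the vector space of fourth-order tensors $E$ with $E_{ijkl}=E_{ijlk}=E_{klij}$. The action of $\mathrm{O}(3)$ is $(g\star E)_{ijkl}=g_{ip}g_{jq}g_{kr}g_{ls}E_{pqrs}$ (similarly for tensors of other orders). Harmonic decomposition: for $E\in\mathbb{E}\mathrm{la}$, set $d:=\operatorname{tr}_{12}E$ ($d_{ij}=E_{kkij}$) and $v:=\operatorname{tr}_{13}E$ ($v_{ij}=E_{kikj}$), $\lambda:=\operatorname{tr} d$, $\mu:=\operatorname{tr} v$, $d':=d-(\lambda/3)q$, $v':=v-(\mu/3)q$, where $q$ is the Euclidean tensor ($q_{ij}=\delta_{ij}$); let $E^s$ be the total symmetrization of $E$ (average over all permutations of the four indices), $a:=\frac27(d+2v)$, $a':=a-\frac13(\operatorname{tr}a)q$, and $$H:=E^s-q\odot a'-\tfrac{7}{30}(\operatorname{tr}a)\,q\odot q,$$ where $S^1\odot S^2$ is the total symmetrization of $S^1\otimes S^2$. Then $H$ is a harmonic (totally symmetric and traceless) fourth-order tensor, and one writes $E=(\lambda,\mu,d',v',H)$. Powers of $H$: $(H^2)_{ijkl}=H_{ijpq}H_{pqkl}$, $H^3=H^2:H$, i.e. $(H^3)_{ijkl}=(H^2)_{ijpq}H_{pqkl}$. Define the symmetric second-order tensors $d_2:=\operatorname{tr}_{13}H^2$ and $d_3:=\operatorname{tr}_{13}H^3$, where $(\operatorname{tr}_{13}T)_{ij}=T_{kikj}$.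 For second-order tensors, $ab$ is the matrix product, $a:b=a_{ij}b_{ij}$ and $[a,b]=ab-ba$. A symmetric second-order tensor is orthotropic if it has three distinct eigenvalues. A pair $(a,b)$ of symmetric second-order tensors is triclinic if $a$ and $b$ have no common principal axis (no common eigenvector); equivalently, the group of rotations in $\mathrm{SO}(3)$ fixing both $a$ and $b$ is trivial. *)

(* Defs.v *)
From mathcomp Require Import all_boot all_order perm all_algebra.
From mathcomp Require Import reals.

Set Implicit Arguments.
Unset Strict Implicit.
Unset Printing Implicit Defensive.

Import Order.TTheory GRing.Theory Num.Theory.
Local Open Scope ring_scope.

(* Second-order tensors on R^3 are 3 x 3 matrices (with their ring structure),
   and the Euclidean tensor q is [1%:M]. *)
Definition tensor4 (R : realType) := 'I_3 -> 'I_3 -> 'I_3 -> 'I_3 -> R.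

Definition orthogonal_group (R : realType) (g : 'M[R]_3) : Prop :=
  g *m g^T = 1%:M.

Definition tensor_act (R : realType) (g : 'M[R]_3) (E : tensor4 R) : tensor4 R :=
  fun i j k l => \sum_(p < 3) \sum_(q < 3) \sum_(r < 3) \sum_(s < 3)
    g i p * g j q * g k r * g l s * E p q r s.

Definition is_ela (R : realType) (E : tensor4 R) : Prop :=
  forall i j k l, E i j k l = E i j l k /\ E i j k l = E k l i j.

Definition tr12 (R : realType) (T : tensor4 R) : 'M[R]_3 :=
  \matrix_(i, j) \sum_(k < 3) T k k i j.

Definition tr13 (R : realType) (T : tensor4 R) : 'M[R]_3 :=
  \matrix_(i, j) \sum_(k < 3) T k i k j.

Definition dev (R : realType) (a : 'M[R]_3) : 'M[R]_3 :=
  a - (\tr a / 3) *: 1%:M.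

(* The numerals 0, 1, 2, 3 are in the ring 'I_4 = Z/4Z, with those values. *)
Definition sym4 (R : realType) (T : tensor4 R) : tensor4 R :=
  fun i j k l =>
    let t := [tuple i; j; k; l] in
    (4`!)%:R^-1 * \sum_(s : 'S_4)
      T (tnth t (s 0)) (tnth t (s 1)) (tnth t (s 2)) (tnth t (s 3)).

Definition odot (R : realType) (a b : 'M[R]_3) : tensor4 R :=
  sym4 (fun i j k l => a i j * b k l).

Definition harmonic_part (R : realType) (E : tensor4 R) : tensor4 R :=
  let a := (2 / 7) *: (tr12 E + 2 *: tr13 E) in
  fun i j k l =>
    sym4 E i j k l - odot 1%:M (dev a) i j k l
    - 7 / 30 * \tr a * odot 1%:M 1%:M i j k l.

Definition ddot4 (R : realType) (S T : tensor4 R) : tensor4 R :=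
  fun i j k l => \sum_(p < 3) \sum_(q < 3) S i j p q * T p q k l.

Definition d2 (R : realType) (E : tensor4 R) : 'M[R]_3 :=
  let H := harmonic_part E in tr13 (ddot4 H H).

Definition d3 (R : realType) (E : tensor4 R) : 'M[R]_3 :=
  let H := harmonic_part E in tr13 (ddot4 (ddot4 H H) H).

Definition ddot (R : realType) (a b : 'M[R]_3) : R :=
  \sum_(i < 3) \sum_(j < 3) a i j * b i j.

Definition bracket (R : realType) (a b : 'M[R]_3) : 'M[R]_3 :=
  a * b - b * a.

(* [eigenvalue] and [eigenspace] refer to row vectors; the next two notions
   are applied to symmetric matrices, where rows and columns agree. *)
Definition orthotropic (R : realType) (a : 'M[R]_3) : Prop :=
  exists x y z : R, [/\ x != y, y != z & x != z]
    /\ [/\ eigenvalue a x, eigenvalue a y & eigenvalue a z].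

Definition triclinic (R : realType) (a b : 'M[R]_3) : Prop :=
  ~ exists (u : 'rV[R]_3) (x y : R),
      [/\ u != 0, (u <= eigenspace a x)%MS & (u <= eigenspace b y)%MS].

(* In the order lambda, mu, I_2, ..., I_10, D_3, ..., D_6, D_11, V_3, ..., V_6, V_11,
   with [a] for d_2 and [b] for d_3. *)
Definition invariants (R : realType) (E : tensor4 R) : 21.-tuple R :=
  let d := tr12 E in
  let v := tr13 E in
  let d' := dev d in
  let v' := dev v in
  let a := d2 E in
  let b := d3 E in
  [tuple \tr d; \tr v;
     \tr a; \tr b; \tr (a ^+ 2); \tr (a * b); \tr (a ^+ 3);
     \tr (a ^+ 2 * b); \tr (a * b ^+ 2); \tr (b ^+ 3);
     \tr (a ^+ 2 * b ^+ 2);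
     ddot d' a; ddot d' b; ddot d' (a ^+ 2); ddot d' (a * b + b * a);
     ddot d' (bracket a b ^+ 2);
     ddot v' a; ddot v' b; ddot v' (a ^+ 2); ddot v' (a * b + b * a);
     ddot v' (bracket a b ^+ 2)].

(* Main.v *)
(* Write a, b for d_2, d_3.  Contracting H with a gives twice the deviator of b,
   and tr b^2 together with the four contractions b:H:b, a^2:H:b, a^2:H:a^2 and
   a^2:H:(ab + ba) are explicit polynomials in the listed invariants.  Hence the
   traces determine (a, b) up to a rotation: in a frame where a is diagonal they
   give the diagonal of b, the squares of its off-diagonal entries and their
   product, so that b is known up to a diagonal matrix of signs.  If two harmonic
   tensors have the same (a, b), their difference K satisfies K:a = 0 and the four
   contractions with K vanish.  The solutions of K:a = 0 form a 4-dimensional space: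
   the contraction with a^2:K:a^2 kills one coordinate, and the other three
   contractions form a 3 x 3 linear system whose determinant is a sum of squares,
   nonzero because (a, b) is triclinic.  A determinant of the same kind shows that
   q, a, b, a^2, ab + ba, [a, b]^2 span the symmetric matrices, which determines
   d' and v'; finally E is determined by d, v and H. *)

Require Import Defs.
From mathcomp Require Import all_boot all_order perm all_algebra.
From mathcomp Require Import boolp reals ring lra.

Set Implicit Arguments.
Unset Strict Implicit.
Unset Printing Implicit Defensive.

Import Order.TTheory GRing.Theory Num.Theory.
Local Open Scope ring_scope.

(** * The orthogonal action and its compatibility with traces and contractions *)

Lemma tensor4P (R : realType) (S T : tensor4 R) :
  (forall i j k l, S i j k l = T i j k l) -> S = T.
Proof. by move=> h; do 4 (apply/funext => ?). Qed.

Lemma orthogonal_groupV (R : realType) (g : 'M[R]_3) :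
  orthogonal_group g -> g^T *m g = 1%:M.
Proof. exact: mulmx1C. Qed.

(** The action on second-order tensors in matrix form, so that invariance statements reduce to
    [g^T *m g = 1%:M]. *)
Definition conj3 (R : realType) (g a : 'M[R]_3) : 'M[R]_3 := g *m a *m g^T.

Lemma conj3E (R : realType) (g a : 'M[R]_3) i j :
  conj3 g a i j = \sum_p \sum_q g i p * g j q * a p q.
Proof.
rewrite /conj3 mxE exchange_big /=; apply: eq_bigr => q _.
by rewrite !mxE mulr_suml; apply: eq_bigr => p _; rewrite mulrAC.
Qed.

Lemma conj3_comp (R : realType) (g h a : 'M[R]_3) :
  conj3 g (conj3 h a) = conj3 (g *m h) a.
Proof. by rewrite /conj3 trmx_mul !mulmxA. Qed.

Lemma conj3D (R : realType) (g a b : 'M[R]_3) :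
  conj3 g (a + b) = conj3 g a + conj3 g b.
Proof. by rewrite /conj3 mulmxDr mulmxDl. Qed.

Lemma conj3B (R : realType) (g a b : 'M[R]_3) :
  conj3 g (a - b) = conj3 g a - conj3 g b.
Proof. by rewrite /conj3 mulmxBr mulmxBl. Qed.

Lemma conj3Z (R : realType) (g a : 'M[R]_3) x :
  conj3 g (x *: a) = x *: conj3 g a.
Proof. by rewrite /conj3 -scalemxAr -scalemxAl. Qed.

(** The actions on the two index pairs are independent finite sums, so either pair can be made the
    outer one. *)
Lemma conj3_swap (R : realType) (g h : 'M[R]_3) (T : tensor4 R) i j k l :
  conj3 h (\matrix_(p, q) conj3 g (\matrix_(r, s) T p q r s) k l) i j =
  conj3 g (\matrix_(r, s) conj3 h (\matrix_(p, q) T p q r s) i j) k l.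
Proof.
rewrite !conj3E.
under eq_bigr => p _ do under eq_bigr => q _ do rewrite mxE conj3E mulr_sumr.
under eq_bigr => p _ do rewrite exchange_big.
rewrite exchange_big; apply: eq_bigr => r _.
under eq_bigr => p _ do under eq_bigr => q _ do rewrite mulr_sumr.
under eq_bigr => p _ do rewrite exchange_big.
rewrite exchange_big; apply: eq_bigr => s _.
rewrite mxE conj3E mulr_sumr; apply: eq_bigr => p _.
rewrite mulr_sumr; apply: eq_bigr => q _; rewrite !mxE; ring.
Qed.

Section Orthogonal.
Variables (R : realType) (g : 'M[R]_3).
Hypothesis og : orthogonal_group g.

Lemma conj3_1 : conj3 g 1%:M = 1%:M.
Proof. by rewrite /conj3 mulmx1. Qed.

Lemma conj3M a b : conj3 g (a * b) = conj3 g a * conj3 g b.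
Proof.
have := orthogonal_groupV og; rewrite /conj3 -!mulmxE !mulmxA => gg.
by rewrite -[g *m a *m g^T *m g]mulmxA gg mulmx1.
Qed.

Lemma conj3X a n : conj3 g (a ^+ n) = conj3 g a ^+ n.
Proof.
elim: n => [|n IH]; first by rewrite !expr0 conj3_1.
by rewrite !exprS conj3M IH.
Qed.

Lemma mxtrace_conj3 a : \tr (conj3 g a) = \tr a.
Proof. by rewrite /conj3 mxtrace_mulC mulmxA orthogonal_groupV ?mul1mx. Qed.

Lemma ddotE a b : ddot a b = \tr (a * b^T) :> R.
Proof.
rewrite /ddot /mxtrace; apply: eq_bigr => i _; rewrite mxE.
by apply: eq_bigr => j _; rewrite mxE.
Qed.

Lemma ddot_conj3 a b : ddot (conj3 g a) (conj3 g b) = ddot a b.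
Proof.
rewrite !ddotE.
have -> : (conj3 g b)^T = conj3 g b^T by rewrite /conj3 !trmx_mul trmxK mulmxA.
by rewrite -conj3M mxtrace_conj3.
Qed.

Lemma dev_conj3 a : dev (conj3 g a) = conj3 g (dev a).
Proof. by rewrite /dev mxtrace_conj3 conj3B conj3Z conj3_1. Qed.

Lemma bracket_conj3 a b : bracket (conj3 g a) (conj3 g b) = conj3 g (bracket a b).
Proof. by rewrite /bracket conj3B !conj3M. Qed.

(** In the form of nested conjugations, the action can be contracted over its outer index pair by
    the invariance of [\tr] and [ddot]. *)
Lemma act_front T i j k l :
  tensor_act g T i j k l =
    conj3 g (\matrix_(p, q) conj3 g (\matrix_(r, s) T p q r s) k l) i j.
Proof.
rewrite /tensor_act conj3E; apply: eq_bigr => p _; apply: eq_bigr => q _.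
rewrite mxE conj3E mulr_sumr; apply: eq_bigr => r _.
rewrite mulr_sumr; apply: eq_bigr => s _; rewrite mxE; ring.
Qed.

Lemma act_back T i j k l :
  tensor_act g T i j k l =
    conj3 g (\matrix_(r, s) conj3 g (\matrix_(p, q) T p q r s) i j) k l.
Proof. by rewrite act_front conj3_swap. Qed.

Lemma tr12_act T : tr12 (tensor_act g T) = conj3 g (tr12 T).
Proof.
apply/matrixP => k l; rewrite mxE.
under eq_bigr => i _ do rewrite act_front.
rewrite -/(\tr _) mxtrace_conj3 conj3E /mxtrace.
under eq_bigr => i _ do rewrite mxE conj3E.
rewrite exchange_big; apply: eq_bigr => r _.
rewrite exchange_big; apply: eq_bigr => s _.
by rewrite mxE mulr_sumr; apply: eq_bigr => p _; rewrite mxE.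
Qed.

(** Slot exchanges commute with the action. This one turns [tr13] into [tr12]; together with
    [swap24] it builds the symmetrization [pair_sum]. *)
Definition swap23 (T : tensor4 R) : tensor4 R := fun i j k l => T i k j l.
Definition swap24 (T : tensor4 R) : tensor4 R := fun i j k l => T i l k j.

Lemma swap23_act T : swap23 (tensor_act g T) = tensor_act g (swap23 T).
Proof.
apply/tensor4P => i j k l; rewrite /swap23 /tensor_act; apply: eq_bigr => p _.
rewrite exchange_big; apply: eq_bigr => q _; apply: eq_bigr => r _.
by apply: eq_bigr => s _; ring.
Qed.

Lemma swap24_act T : swap24 (tensor_act g T) = tensor_act g (swap24 T).
Proof.
apply/tensor4P => i j k l; rewrite /swap24 /tensor_act; apply: eq_bigr => p _.
under eq_bigr => q _ do rewrite exchange_big.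
rewrite exchange_big /=.
under eq_bigr => q _ do rewrite exchange_big.
apply: eq_bigr => q _; apply: eq_bigr => r _.
by apply: eq_bigr => s _; ring.
Qed.

Lemma tr13_swap T : tr13 T = tr12 (swap23 T).
Proof. by apply/matrixP => i j; rewrite !mxE. Qed.

Lemma tr13_act T : tr13 (tensor_act g T) = conj3 g (tr13 T).
Proof. by rewrite !tr13_swap swap23_act tr12_act. Qed.

Lemma ddot4_act S T :
  ddot4 (tensor_act g S) (tensor_act g T) = tensor_act g (ddot4 S T).
Proof.
apply/tensor4P => i j k l; rewrite /ddot4.
under eq_bigr => p _ do under eq_bigr => q _ do rewrite act_back act_front.
(* The sum over the contracted pair is a scalar product of two conjugated matrices, so [g] cancels
   there. The rest reorders finite sums. *)
rewrite -/(ddot _ _) ddot_conj3 act_front conj3E /ddot.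
under eq_bigr => p _ do under eq_bigr => q _ do
  rewrite [X in X * _]mxE [X in _ * X]mxE conj3E mulr_suml.
under eq_bigr => p _ do rewrite exchange_big.
rewrite exchange_big; apply: eq_bigr => i' _ /=.
under eq_bigr => p _ do under eq_bigr => q _ do rewrite mulr_suml.
under eq_bigr => p _ do rewrite exchange_big.
rewrite exchange_big; apply: eq_bigr => j' _ /=.
rewrite mxE !conj3E mulr_sumr.
under eq_bigr => p _ do under eq_bigr => q _ do rewrite conj3E mulr_sumr.
under eq_bigr => p _ do rewrite exchange_big.
rewrite exchange_big; apply: eq_bigr => k' _ /=.
rewrite mulr_sumr.
under eq_bigr => p _ do under eq_bigr => q _ do rewrite mulr_sumr.
under eq_bigr => p _ do rewrite exchange_big.
rewrite exchange_big; apply: eq_bigr => l' _ /=.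
rewrite mxE !mulr_sumr; apply: eq_bigr => p _.
rewrite !mulr_sumr; apply: eq_bigr => q _; rewrite !mxE; ring.
Qed.

Lemma act_tensor_product (a b : 'M[R]_3) :
  tensor_act g (fun i j k l => a i j * b k l) =
  fun i j k l => conj3 g a i j * conj3 g b k l.
Proof.
apply/tensor4P => i j k l; rewrite /tensor_act !conj3E mulr_suml.
apply: eq_bigr => p _; rewrite mulr_suml; apply: eq_bigr => q _.
rewrite mulr_sumr; apply: eq_bigr => r _; rewrite mulr_sumr.
by apply: eq_bigr => s _; ring.
Qed.

End Orthogonal.

Lemma act_comp (R : realType) (g h : 'M[R]_3) T :
  tensor_act g (tensor_act h T) = tensor_act (g *m h) T.
Proof.
apply/tensor4P => i j k l; rewrite !act_front -conj3_comp.
congr (conj3 g _ i j); apply/matrixP => p q; rewrite [LHS]mxE.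
transitivity (conj3 g (conj3 h
  (\matrix_(r, s) conj3 h (\matrix_(p', q') T p' q' r s) p q)) k l).
  by congr (conj3 g _ k l); apply/matrixP => r s; rewrite mxE act_back.
by rewrite conj3_comp -conj3_swap.
Qed.

Lemma act1 (R : realType) (T : tensor4 R) : tensor_act 1%:M T = T.
Proof.
have c1 (a : 'M[R]_3) : conj3 1%:M a = a by rewrite /conj3 trmx1 mulmx1 mul1mx.
by apply/tensor4P => i j k l; rewrite act_front c1 mxE c1 mxE.
Qed.

(** * Total symmetrization as an explicit sum of 24 terms *)

(** A permutation of four points amounts to a quadruple of distinct values, and sums over quadruples
    can be unfolded term by term. *)
Lemma sum_S4 (V : nmodType) (F : 'I_4 -> 'I_4 -> 'I_4 -> 'I_4 -> V) :
  \sum_(s : 'S_4) F (s 0) (s 1) (s 2) (s 3) =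
  \sum_i \sum_j \sum_k \sum_m if uniq [:: i; j; k; m] then F i j k m else 0.
Proof.
have S1 (s : 'S_4) : F (s 0) (s 1) (s 2) (s 3) = \sum_i \sum_j \sum_k \sum_m
    if [&& s 0 == i, s 1 == j, s 2 == k & s 3 == m] then F i j k m else 0.
  rewrite (bigD1 (s 0)) //= (bigD1 (s 1)) //= (bigD1 (s 2)) //= (bigD1 (s 3)) //=.
  rewrite !eqxx /= !big1 ?addr0 // => [i /negPf|i /negPf|i /negPf|i /negPf];
    rewrite eq_sym => ->; rewrite ?andbF // ?big1 // => ? _; rewrite ?big1 // => ? _.
  by rewrite big1.
under eq_bigr => s _ do rewrite S1.
rewrite exchange_big; apply: eq_bigr => i _.
rewrite exchange_big; apply: eq_bigr => j _.
rewrite exchange_big; apply: eq_bigr => k _.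
rewrite exchange_big; apply: eq_bigr => m _; rewrite -big_mkcond /=.
case: ifPn => [Uijkm|/negP nU]; last first.
  apply: big_pred0 => s; apply/negP => /and4P[/eqP si /eqP sj /eqP sk /eqP sm].
  by apply: nU; rewrite -si -sj -sk -sm !inE !(inj_eq perm_inj).
(* For distinct values the list itself defines the only matching permutation. The default [i] of
   [nth] is never reached, since [a < 4]. *)
pose f (a : 'I_4) := nth i [:: i; j; k; m] a.
have f_inj : injective f.
  move=> a b; rewrite /f => /eqP; rewrite nth_uniq ?ltn_ord //.
  by move=> /eqP /val_inj.
rewrite (big_pred1 (perm f_inj)) // => s; apply/idP/eqP => [|->]; last first.
  by rewrite !permE /f /= !eqxx.
move=> /and4P[/eqP si /eqP sj /eqP sk /eqP sm]; apply/permP => a; rewrite permE /f.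
by case: a => [[|[|[|[|]]]] ha] //=; rewrite -1?si -1?sj -1?sk -1?sm; congr (s _);
  apply: val_inj.
Qed.

Lemma big_ord4 (V : nmodType) (F : 'I_4 -> V) :
  \sum_i F i = F 0 + F 1 + F 2 + F 3.
Proof.
by rewrite !big_ord_recl big_ord0 addr0 !addrA; do ?congr (_ + _); congr F;
  apply: val_inj.
Qed.

Lemma sym4E (R : realType) (T : tensor4 R) i j k l :
  sym4 T i j k l = 24^-1 *
  (T i j k l + T i j l k + T i k j l + T i k l j + T i l j k + T i l k j
 + T j i k l + T j i l k + T j k i l + T j k l i + T j l i k + T j l k i
 + T k i j l + T k i l j + T k j i l + T k j l i + T k l i j + T k l j i
 + T l i j k + T l i k j + T l j i k + T l j k i + T l k i j + T l k j i).
Proof.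
rewrite /sym4; congr (_ * _).
rewrite (sum_S4 (fun a b c d => T (tnth [tuple i; j; k; l] a)
  (tnth [tuple i; j; k; l] b) (tnth [tuple i; j; k; l] c) (tnth [tuple i; j; k; l] d))).
under eq_bigr => a _ do under eq_bigr => b _ do under eq_bigr => c _ do
  rewrite big_ord4.
under eq_bigr => a _ do under eq_bigr => b _ do rewrite big_ord4.
under eq_bigr => a _ do rewrite big_ord4.
rewrite big_ord4 /= !(tnth_nth i) /=.
rewrite !(add0r, addr0) !addrA.
by [].
Qed.

(** * The harmonic part: expression as a pair sum, equivariance, harmonicity *)

Lemma addmxE (R : realType) m n (a b : 'M[R]_(m, n)) i j :
  (a + b) i j = a i j + b i j.
Proof. by rewrite mxE. Qed.

Lemma oppmxE (R : realType) m n (a : 'M[R]_(m, n)) i j : (- a) i j = - a i j.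
Proof. by rewrite mxE. Qed.

Lemma scalemxE (R : realType) m n x (a : 'M[R]_(m, n)) i j :
  (x *: a) i j = x * a i j.
Proof. by rewrite mxE. Qed.

Lemma act_linear (R : realType) (g : 'M[R]_3) (S T : tensor4 R) x y :
  tensor_act g (fun i j k l => x * S i j k l + y * T i j k l) =
  fun i j k l => x * tensor_act g S i j k l + y * tensor_act g T i j k l.
Proof.
apply/tensor4P => i j k l; rewrite /tensor_act !mulr_sumr -big_split.
apply: eq_bigr => p _; rewrite !mulr_sumr -big_split.
apply: eq_bigr => q _; rewrite !mulr_sumr -big_split.
apply: eq_bigr => r _; rewrite !mulr_sumr -big_split.
by apply: eq_bigr => s _ /=; ring.
Qed.

(** The three terms are the three ways of splitting four slots into two pairs. *)
Definition pair_sum (R : realType) (T : tensor4 R) : tensor4 R :=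
  fun i j k l => T i j k l + T i k j l + T i l k j.

Lemma act_add (R : realType) (g : 'M[R]_3) (S T : tensor4 R) :
  tensor_act g (fun i j k l => S i j k l + T i j k l) =
  fun i j k l => tensor_act g S i j k l + tensor_act g T i j k l.
Proof.
have := act_linear g S T 1 1; set U := fun i j k l => _.
have -> : U = fun i j k l => S i j k l + T i j k l.
  by apply/tensor4P => i j k l; rewrite /U !mul1r.
by move=> ->; apply/tensor4P => i j k l; rewrite !mul1r.
Qed.

Lemma pair_sum_act (R : realType) (g : 'M[R]_3) (T : tensor4 R) :
  pair_sum (tensor_act g T) = tensor_act g (pair_sum T).
Proof.
rewrite /pair_sum -[fun i j k l => T i j k l + T i k j l + T i l k j]/(fun i j k l =>
  (fun i j k l => T i j k l + swap23 T i j k l) i j k l + swap24 T i j k l).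
by rewrite !act_add -swap23_act -swap24_act.
Qed.

Lemma act_ela (R : realType) (g : 'M[R]_3) (E : tensor4 R) :
  is_ela E -> is_ela (tensor_act g E).
Proof.
move=> hE i j k l; split.
  rewrite /tensor_act; apply: eq_bigr => p _; apply: eq_bigr => q _.
  rewrite exchange_big; apply: eq_bigr => r _; apply: eq_bigr => s _.
  by rewrite (hE p q s r).1; ring.
rewrite !act_front [LHS]conj3_swap; congr (conj3 g _ k l).
apply/matrixP => r s; rewrite [LHS]mxE [RHS]mxE; congr (conj3 g _ i j).
by apply/matrixP => p q; rewrite !mxE (hE r s p q).2.
Qed.

Lemma ela_tr12 (R : realType) (E : tensor4 R) : is_ela E -> (tr12 E)^T = tr12 E.
Proof.
move=> hE; apply/matrixP => i j; rewrite !mxE.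
by apply: eq_bigr => k _; rewrite (hE _ _ _ _).1.
Qed.

Lemma ela_tr13 (R : realType) (E : tensor4 R) : is_ela E -> (tr13 E)^T = tr13 E.
Proof.
move=> hE; apply/matrixP => i j; rewrite !mxE.
by apply: eq_bigr => k _; rewrite (hE _ _ _ _).2.
Qed.

Definition totally_symmetric (R : realType) (T : tensor4 R) : Prop :=
  forall i j k l, [/\ T i j k l = T j i k l, T i j k l = T i k j l
                    & T i j k l = T i j l k].

Definition harmonic4 (R : realType) (H : tensor4 R) : Prop :=
  totally_symmetric H /\ tr12 H = 0.

(** For symmetric [m] this product of [q] and [m] has the elasticity symmetries, so that
    [odot 1%:M m] is a pair sum as well. *)
Definition delta_sym (R : realType) (m : 'M[R]_3) : tensor4 R :=
  fun i j k l => 1%:M i j * m k l + m i j * 1%:M k l.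

Lemma odot1E (R : realType) (m : 'M[R]_3) : m^T = m ->
  odot 1%:M m = fun i j k l => 6^-1 * pair_sum (delta_sym m) i j k l.
Proof.
move=> ms; have mC i j : m i j = m j i by rewrite -{1}ms mxE.
have dC i j : (1%:M : 'M[R]_3) i j = 1%:M j i by rewrite -{1}trmx1 mxE.
apply/tensor4P => i j k l; rewrite /odot sym4E /pair_sum /delta_sym.
rewrite (mC j i) (mC k i) (mC l i) (mC k j) (mC l j) (mC l k).
rewrite (dC j i) (dC k i) (dC l i) (dC k j) (dC l j) (dC l k).
by move: (1%:M : 'M[R]_3) => q; field.
Qed.

Lemma ela_sym (R : realType) (E : tensor4 R) i j k l : is_ela E ->
  [/\ E i j l k = E i j k l, E j i k l = E i j k l & E j i l k = E i j k l] /\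
  [/\ E k l i j = E i j k l, E l k i j = E i j k l,
      E k l j i = E i j k l & E l k j i = E i j k l].
Proof.
move=> hE; have r a b c d : E a b c d = E a b d c := (hE a b c d).1.
have s a b c d : E a b c d = E c d a b := (hE a b c d).2.
have t a b c d : E a b c d = E b a c d by rewrite s r s.
have [e1 e2 e3] : [/\ E i j l k = E i j k l, E j i k l = E i j k l
    & E j i l k = E i j k l].
  by rewrite -(r i j k l) -(t i j k l) -(r j i k l) -(t i j k l).
by split; split=> //; rewrite s.
Qed.

(** The eight index symmetries of [E] group the 24 permutations into three classes of equal terms,
    one for each pairing of the slots. *)
Lemma sym4_ela (R : realType) (E : tensor4 R) : is_ela E ->
  sym4 E = fun i j k l => 3^-1 * pair_sum E i j k l.
Proof.
move=> hE; apply/tensor4P => i j k l; rewrite sym4E /pair_sum.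
have [[-> -> ->] [-> -> -> ->]] := ela_sym i j k l hE.
have [[-> -> ->] [-> -> -> ->]] := ela_sym i k j l hE.
have [[-> -> ->] [-> -> -> ->]] := ela_sym i l k j hE.
by field.
Qed.

Lemma pair_sum_totally_symmetric (R : realType) (E : tensor4 R) :
  is_ela E -> totally_symmetric (pair_sum E).
Proof.
move=> hE i j k l; rewrite /pair_sum.
have [[e1 e2 _] _] := ela_sym i j k l hE.
have [[f1 _ _] [_ _ f2 _]] := ela_sym i k j l hE.
have [[g1 _ _] [_ g2 _ _]] := ela_sym i l k j hE.
by rewrite e1 e2 f1 f2 g1 g2; split; ring.
Qed.

Lemma tr12_pair_sum (R : realType) (E : tensor4 R) :
  is_ela E -> tr12 (pair_sum E) = tr12 E + 2 *: tr13 E.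
Proof.
move=> hE; apply/matrixP => i j; rewrite !mxE mulr_sumr -big_split.
apply: eq_bigr => k _; rewrite /pair_sum /=.
by have [[-> _ _] _] := ela_sym k j k i hE; rewrite -(hE k i k j).2; ring.
Qed.

Lemma tr12_linear (R : realType) (S T : tensor4 R) x y :
  tr12 (fun i j k l => x * S i j k l + y * T i j k l) = x *: tr12 S + y *: tr12 T.
Proof. by apply/matrixP => i j; rewrite !mxE !mulr_sumr -big_split. Qed.

Lemma tr13_linear (R : realType) (S T : tensor4 R) x y :
  tr13 (fun i j k l => x * S i j k l + y * T i j k l) = x *: tr13 S + y *: tr13 T.
Proof. by apply/matrixP => i j; rewrite !mxE !mulr_sumr -big_split. Qed.

Lemma tr12_delta_sym (R : realType) (m : 'M[R]_3) :
  tr12 (delta_sym m) = 3 *: m + \tr m *: 1%:M.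
Proof.
apply/matrixP => i j; rewrite mxE big_split /= -!mulr_suml.
by rewrite -/(\tr m) -/(\tr (1%:M : 'M[R]_3)) mxtrace1 addmxE !scalemxE.
Qed.

Lemma tr13_delta_sym (R : realType) (m : 'M[R]_3) :
  m^T = m -> tr13 (delta_sym m) = 2 *: m.
Proof.
move=> ms; have e : (1%:M)^T *m m + m^T *m 1%:M = 2 *: m.
  by rewrite ms trmx1 mul1mx mulmx1 scaler_nat mulr2n.
apply/matrixP => i j; rewrite -e !mxE big_split /=.
by congr (_ + _); apply: eq_bigr => k _; rewrite [in RHS]mxE.
Qed.

Lemma tr_dev (R : realType) (a : 'M[R]_3) : (dev a)^T = dev a^T.
Proof. by rewrite /dev linearB linearZ /= trmx1 mxtrace_tr. Qed.

(** As [odot 1%:M] is linear, the two terms subtracted from the symmetrization of [E] combine into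
    one [odot 1%:M m]; this is that [m]. *)
Definition harmonic_correction (R : realType) (E : tensor4 R) : 'M[R]_3 :=
  let a := (2 / 7) *: (tr12 E + 2 *: tr13 E) in
  dev a + (7 / 30 * \tr a) *: 1%:M.

(** Writing [H] as the pair sum of one tensor with the elasticity symmetries reduces its
    equivariance, symmetry and trace to those of [pair_sum]. *)
Lemma harmonic_partE (R : realType) (E : tensor4 R) : is_ela E ->
  harmonic_part E = pair_sum (fun i j k l =>
    3^-1 * E i j k l + (- 6^-1) * delta_sym (harmonic_correction E) i j k l).
Proof.
move=> hE; apply/tensor4P => i j k l; rewrite /harmonic_part.
set a := _ *: _; have asym : a^T = a.
  by rewrite /a !linearZ /= linearD /= linearZ /= ela_tr12 ?ela_tr13.
rewrite sym4_ela // !odot1E ?trmx1 //; last first.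
  by rewrite tr_dev asym.
have mE p q : harmonic_correction E p q = dev a p q + 7 / 30 * \tr a * 1%:M p q.
  by rewrite /harmonic_correction -/a mxE [X in _ + X]mxE.
by rewrite /pair_sum /delta_sym !mE; field.
Qed.

Lemma harmonic_part_act (R : realType) (g : 'M[R]_3) (E : tensor4 R) :
  orthogonal_group g -> is_ela E ->
  harmonic_part (tensor_act g E) = tensor_act g (harmonic_part E).
Proof.
move=> og hE; rewrite !harmonic_partE //; last exact: act_ela.
rewrite -pair_sum_act act_linear; congr pair_sum.
have -> : harmonic_correction (tensor_act g E) = conj3 g (harmonic_correction E).
  rewrite /harmonic_correction tr12_act // tr13_act // -conj3Z -conj3D -conj3Z.
  by rewrite dev_conj3 // mxtrace_conj3 // conj3D conj3Z conj3_1.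
set m := harmonic_correction E.
suff -> : delta_sym (conj3 g m) = tensor_act g (delta_sym m) by [].
by rewrite /delta_sym act_add !act_tensor_product // conj3_1.
Qed.

Lemma d2_act (R : realType) (g : 'M[R]_3) (E : tensor4 R) :
  orthogonal_group g -> is_ela E -> d2 (tensor_act g E) = conj3 g (d2 E).
Proof. by move=> og hE; rewrite /d2 harmonic_part_act // ddot4_act // tr13_act. Qed.

Lemma d3_act (R : realType) (g : 'M[R]_3) (E : tensor4 R) :
  orthogonal_group g -> is_ela E -> d3 (tensor_act g E) = conj3 g (d3 E).
Proof. by move=> og hE; rewrite /d3 harmonic_part_act // !ddot4_act // tr13_act. Qed.

Lemma invariants_act (R : realType) (g : 'M[R]_3) (E : tensor4 R) :
  orthogonal_group g -> is_ela E ->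
  invariants (tensor_act g E) = invariants E.
Proof.
move=> og hE; apply: val_inj; rewrite /= d2_act // d3_act // tr12_act // tr13_act //.
rewrite !dev_conj3 // bracket_conj3 // -!conj3X // -!conj3M // -!conj3D.
by rewrite !ddot_conj3 // !mxtrace_conj3.
Qed.

(** The constants 2/7 and 7/30 serve tracelessness: with [m] the correction, the trace is
    [7/6 a - (7 m + (tr m) q) / 6], and [7 m + (tr m) q = 7 a]. *)
Lemma harmonic_part_harmonic (R : realType) (E : tensor4 R) :
  is_ela E -> harmonic4 (harmonic_part E).
Proof.
move=> hE; pose a := (2 / 7) *: (tr12 E + 2 *: tr13 E).
have asym : a^T = a.
  by rewrite /a !linearZ /= linearD /= linearZ /= ela_tr12 ?ela_tr13.
have ms : (harmonic_correction E)^T = harmonic_correction E.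
  rewrite /harmonic_correction -/a linearD /= linearZ /= trmx1.
  by rewrite tr_dev asym.
rewrite harmonic_partE //.
set U : tensor4 R := fun i j k l => _.
have hU : is_ela U.
  move: ms; set m := harmonic_correction E => ms i j k l.
  have mC p q : m p q = m q p by rewrite -{1}ms mxE.
  have dC p q : (1%:M : 'M[R]_3) p q = 1%:M q p by rewrite -{1}trmx1 mxE.
  rewrite /U -(hE i j k l).1 -(hE i j k l).2 /delta_sym -/m (mC l k) (dC l k).
  by split; ring.
split; first exact: pair_sum_totally_symmetric.
rewrite tr12_pair_sum // /U tr12_linear tr13_linear tr12_delta_sym tr13_delta_sym //.
have -> : \tr (harmonic_correction E) = 7 / 10 * \tr a.
  rewrite /harmonic_correction -/a /dev !linearD /= linearN /= !linearZ /= mxtrace1.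
  by field.
have ea : tr12 E = (7 / 2) *: a - 2 *: tr13 E.
  rewrite /a scalerA [_ * _](_ : _ = 1); first by rewrite scale1r addrK.
  by field.
rewrite ea /harmonic_correction -/a /dev; apply/matrixP => i j.
by rewrite !(addmxE, oppmxE, scalemxE) [RHS]mxE; field.
Qed.

(** * Reconstruction of an elasticity tensor from its traces and harmonic part *)

Lemma sum_I3 (V : nmodType) (F : 'I_3 -> V) i j k :
  i != j -> i != k -> j != k -> \sum_m F m = F i + F j + F k.
Proof.
move=> ij ik jk; rewrite (bigD1 i) //= (bigD1 j) ?[j == i]eq_sym //= (bigD1 k) /=.
  rewrite big1 ?addr0 ?addrA // => m /andP[/andP[mi mj] mk].
  have : uniq [:: i; j; k; m].
    by rewrite /= !inE !negb_or ij ik jk ![_ == m]eq_sym mi mj mk.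
  by move=> /card_uniqP U; have := max_card (mem [:: i; j; k; m]); rewrite U card_ord.
by rewrite ![k == _]eq_sym ik jk.
Qed.

Lemma third_index (i j : 'I_3) : i != j -> {k | i != k & j != k}.
Proof.
by case: i j => [[|[|[|]]] ? //] [[|[|[|]]] ? //] //= _;
  (exists ord0 + exists (inord 1) + exists ord_max); rewrite // -val_eqE /= inordK.
Qed.

(** A zero pair sum gives [T_ikil = - T_iikl / 2], hence [T_iiil = 0]; the trace equations then kill
    every [T_iikl]. Any four indices out of three values repeat, so these components suffice. *)
Lemma ela_eq0 (R : realType) (T : tensor4 R) : is_ela T ->
  tr12 T = 0 -> tr13 T = 0 -> (forall i j k l, pair_sum T i j k l = 0) ->
  forall i j k l, T i j k l = 0.
Proof.
move=> hT d0 v0 c0.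
have mixed i k l : T i k i l = - 2^-1 * T i i k l.
  have := c0 i i k l; rewrite /pair_sum; have [_ [_ _ -> _]] := ela_sym i k i l hT => h.

  lra.
have d0E i j : \sum_k T k k i j = 0 by move/matrixP/(_ i j): d0; rewrite !mxE.
have three i l : T i i i l = 0.
  by have := mixed i i l; lra.
have three' i l : T i i l i = 0 by rewrite (hT _ _ _ _).1.
have front i k l : T i i k l = 0.
  have [-> //|ik] := eqVneq i k; have [->|il] := eqVneq i l; first exact: three'.
  have [kl|kl] := eqVneq k l; last first.
    by have := d0E k l; rewrite (sum_I3 _ ik il kl) three three' !addr0.
  (* By the diagonal of [tr12 T = 0], the unknowns [T_iikk], [T_iimm] and [T_kkmm] have zero
     pairwise sums, so each is zero. *)
  rewrite -{}kl {l il}; have [m im km] := third_index ik.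
  have := d0E i i; have := d0E k k; have := d0E m m.
  rewrite !(sum_I3 _ ik im km) !three (hT k k i i).2 (hT m m i i).2 (hT m m k k).2.
  by lra.
have mixed0 i k l : T i k i l = 0 by rewrite mixed front mulr0.
move=> i j k l; have [->|ij] := eqVneq i j; first exact: front.
have [->|kl] := eqVneq k l; first by rewrite (hT _ _ _ _).2 front.
have [->|ik] := eqVneq i k; first exact: mixed0.
have [->|il] := eqVneq i l; first by rewrite (hT _ _ _ _).1 mixed0.
have [[_ e _] _] := ela_sym i j k l hT; rewrite -e.
have [->|jk] := eqVneq j k; first exact: mixed0.
have [->|jl] := eqVneq j l; first by rewrite (hT _ _ _ _).1 mixed0.
(* The remaining case would have four distinct indices in ['I_3]. *)
have : uniq [:: i; j; k; l] by rewrite /= !inE !negb_or ij ik il jk jl kl.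
by move=> /card_uniqP U; have := max_card (mem [:: i; j; k; l]); rewrite U card_ord.
Qed.

Lemma ela_inj (R : realType) (E F : tensor4 R) : is_ela E -> is_ela F ->
  tr12 E = tr12 F -> tr13 E = tr13 F -> harmonic_part E = harmonic_part F -> E = F.
Proof.
move=> hE hF d v h; pose T : tensor4 R := fun i j k l => 1 * E i j k l + (-1) * F i j k l.
have T0 : forall i j k l, T i j k l = 0.
  apply: ela_eq0.
  - move=> i j k l; rewrite /T; have [-> ->] := hE i j k l; have [-> ->] := hF i j k l.
    by [].
  - by rewrite /T tr12_linear d scale1r scaleN1r subrr.
  - by rewrite /T tr13_linear v scale1r scaleN1r subrr.
  (* Equal traces give equal corrections, so equality of the harmonic parts leaves exactly the pair
     sum of [T]. *)
  move=> i j k l; move: h; rewrite !harmonic_partE // => /(congr1 (fun H => H i j k l)).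
  by rewrite /T /pair_sum /harmonic_correction d v; lra.
by apply/tensor4P => i j k l; have := T0 i j k l; rewrite /T; lra.
Qed.

(** * Coordinates on symmetric matrices and harmonic tensors *)

Definition o0 : 'I_3 := @Ordinal 3 0 isT.
Definition o1 : 'I_3 := @Ordinal 3 1 isT.
Definition o2 : 'I_3 := @Ordinal 3 2 isT.

Lemma I3P (P : 'I_3 -> Prop) : P o0 -> P o1 -> P o2 -> forall i, P i.
Proof.
move=> h0 h1 h2 [[|[|[|]]] lt3] //.
- by rewrite (_ : Ordinal lt3 = o0) //; apply: val_inj.
- by rewrite (_ : Ordinal lt3 = o1) //; apply: val_inj.
- by rewrite (_ : Ordinal lt3 = o2) //; apply: val_inj.
Qed.

Lemma big_I3 (V : nmodType) (F : 'I_3 -> V) : \sum_i F i = F o0 + F o1 + F o2.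
Proof. exact: sum_I3. Qed.

(** Entries come in the Voigt order 11, 22, 33, 23, 13, 12; the default case is 12 and 21. The type
    [A] is arbitrary so that nesting tabulates a fourth-order tensor. *)
Definition pick3 (A : Type) (x11 x22 x33 x23 x13 x12 : A) (i j : 'I_3) : A :=
  match nat_of_ord i, nat_of_ord j with
  | 0, 0 => x11 | 1, 1 => x22 | 2, 2 => x33
  | 1, 2 | 2, 1 => x23
  | 0, 2 | 2, 0 => x13
  | _, _ => x12
  end%N.

Definition sym3 (R : realType) (x11 x22 x33 x23 x13 x12 : R) : 'M[R]_3 :=
  \matrix_(i, j) pick3 x11 x22 x33 x23 x13 x12 i j.

(* The nine free components of a harmonic tensor: [x1], [x2], [x3] stand for
   H_2233, H_1133, H_1122, and [u1], [u2] (resp. [v1], [v2] and [w1], [w2]) for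
   H_23ii (resp. H_13ii and H_12ii) with i = 1, 2. *)
Definition harm (R : realType) (x1 x2 x3 u1 u2 v1 v2 w1 w2 : R) : tensor4 R :=
  pick3
    (pick3 (- (x2 + x3)) x3 x2 u1 v1 w1)
    (pick3 x3 (- (x1 + x3)) x1 u2 v2 w2)
    (pick3 x2 x1 (- (x1 + x2)) (- (u1 + u2)) (- (v1 + v2)) (- (w1 + w2)))
    (pick3 u1 u2 (- (u1 + u2)) x1 (- (w1 + w2)) v2)
    (pick3 v1 v2 (- (v1 + v2)) (- (w1 + w2)) x2 u1)
    (pick3 w1 w2 (- (w1 + w2)) v2 u1 x3).

Ltac eval_harm := cbv beta iota delta [harm pick3 o0 o1 o2 nat_of_ord].

Definition contract (R : realType) (H : tensor4 R) (m : 'M[R]_3) : 'M[R]_3 :=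
  \matrix_(i, j) \sum_k \sum_l H i j k l * m k l.

Lemma sym3P (R : realType) (m : 'M[R]_3) : m^T = m ->
  m = sym3 (m o0 o0) (m o1 o1) (m o2 o2) (m o1 o2) (m o0 o2) (m o0 o1).
Proof.
move=> ms; have mC i j : m i j = m j i by rewrite -{1}ms mxE.
by apply/matrixP; apply: I3P; apply: I3P; rewrite [RHS]mxE /pick3 /= // mC.
Qed.

(** Of the 15 components with sorted indices, the six trace equations eliminate six. *)
Lemma harmP (R : realType) (H : tensor4 R) : harmonic4 H ->
  H = harm (H o1 o1 o2 o2) (H o0 o0 o2 o2) (H o0 o0 o1 o1) (H o0 o0 o1 o2)
    (H o1 o1 o1 o2) (H o0 o0 o0 o2) (H o0 o1 o1 o2) (H o0 o0 o0 o1) (H o0 o1 o1 o1).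
Proof.
move=> [hs ht].
have a10 k l : H o1 o0 k l = H o0 o1 k l by have [] := hs o1 o0 k l.
have a20 k l : H o2 o0 k l = H o0 o2 k l by have [] := hs o2 o0 k l.
have a21 k l : H o2 o1 k l = H o1 o2 k l by have [] := hs o2 o1 k l.
have b10 k l : H k o1 o0 l = H k o0 o1 l by have [] := hs k o1 o0 l.
have b20 k l : H k o2 o0 l = H k o0 o2 l by have [] := hs k o2 o0 l.
have b21 k l : H k o2 o1 l = H k o1 o2 l by have [] := hs k o2 o1 l.
have c10 k l : H k l o1 o0 = H k l o0 o1 by have [] := hs k l o1 o0.
have c20 k l : H k l o2 o0 = H k l o0 o2 by have [] := hs k l o2 o0.
have c21 k l : H k l o2 o1 = H k l o1 o2 by have [] := hs k l o2 o1.
have sortE := (a10, a20, a21, b10, b20, b21, c10, c20, c21).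
have tE i j : H o0 o0 i j + H o1 o1 i j + H o2 o2 i j = 0.
  by move/matrixP/(_ i j): ht; rewrite !mxE big_I3.
have t00 : H o0 o0 o0 o0 = - (H o0 o0 o2 o2 + H o0 o0 o1 o1).
  by have := tE o0 o0; rewrite ?sortE; lra.
have t11 : H o1 o1 o1 o1 = - (H o1 o1 o2 o2 + H o0 o0 o1 o1).
  by have := tE o1 o1; rewrite ?sortE; lra.
have t22 : H o2 o2 o2 o2 = - (H o1 o1 o2 o2 + H o0 o0 o2 o2).
  by have := tE o2 o2; rewrite ?sortE; lra.
have t12 : H o1 o2 o2 o2 = - (H o0 o0 o1 o2 + H o1 o1 o1 o2).
  by have := tE o1 o2; rewrite ?sortE; lra.
have t02 : H o0 o2 o2 o2 = - (H o0 o0 o0 o2 + H o0 o1 o1 o2).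
  by have := tE o0 o2; rewrite ?sortE; lra.
have t01 : H o0 o1 o2 o2 = - (H o0 o0 o0 o1 + H o0 o1 o1 o1).
  by have := tE o0 o1; rewrite ?sortE; lra.
apply/tensor4P; do 4 apply: I3P; rewrite /harm /pick3 /=;
  by rewrite ?sortE ?(t00, t11, t22, t12, t02, t01).
Qed.

Lemma sym3E (R : realType) (x11 x22 x33 x23 x13 x12 : R) :
  (sym3 x11 x22 x33 x23 x13 x12 o0 o0 = x11) *
  (sym3 x11 x22 x33 x23 x13 x12 o1 o1 = x22) *
  (sym3 x11 x22 x33 x23 x13 x12 o2 o2 = x33) *
  (sym3 x11 x22 x33 x23 x13 x12 o1 o2 = x23) *
  (sym3 x11 x22 x33 x23 x13 x12 o2 o1 = x23) *
  (sym3 x11 x22 x33 x23 x13 x12 o0 o2 = x13) *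
  (sym3 x11 x22 x33 x23 x13 x12 o2 o0 = x13) *
  (sym3 x11 x22 x33 x23 x13 x12 o0 o1 = x12) *
  (sym3 x11 x22 x33 x23 x13 x12 o1 o0 = x12).
Proof. by rewrite !mxE /pick3 /=. Qed.

Lemma contract_harm (R : realType)
    (x1 x2 x3 u1 u2 v1 v2 w1 w2 a11 a22 a33 a23 a13 a12 : R) :
  contract (harm x1 x2 x3 u1 u2 v1 v2 w1 w2) (sym3 a11 a22 a33 a23 a13 a12) = sym3
   (x3 * (a22 - a11) + x2 * (a33 - a11) + 2 * (u1 * a23 + v1 * a13 + w1 * a12))
   (x3 * (a11 - a22) + x1 * (a33 - a22) + 2 * (u2 * a23 + v2 * a13 + w2 * a12))
   (x2 * (a11 - a33) + x1 * (a22 - a33)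
     - 2 * ((u1 + u2) * a23 + (v1 + v2) * a13 + (w1 + w2) * a12))
   (u1 * (a11 - a33) + u2 * (a22 - a33) + 2 * (x1 * a23 - (w1 + w2) * a13 + v2 * a12))
   (v1 * (a11 - a33) + v2 * (a22 - a33) + 2 * (x2 * a13 - (w1 + w2) * a23 + u1 * a12))
   (w1 * (a11 - a33) + w2 * (a22 - a33) + 2 * (x3 * a12 + v2 * a23 + u1 * a13)).
Proof.
apply/matrixP; do 2 apply: I3P; rewrite mxE !big_I3 !sym3E; eval_harm; ring.
Qed.

(** * The covariants [d_2] and [d_3] in coordinates *)

Definition sq_trace (R : realType) (H : tensor4 R) : 'M[R]_3 := tr13 (ddot4 H H).
Definition cube_trace (R : realType) (H : tensor4 R) : 'M[R]_3 :=
  tr13 (ddot4 (ddot4 H H) H).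

(** This cubic is [I_3 = tr d_3]. As a named constant it can later be abstracted into a single
    variable. *)
Definition harm_cube_trace (R : realType) (x1 x2 x3 u1 u2 v1 v2 w1 w2 : R) : R :=
    - 6 * x1 ^+ 2 * x2 - 6 * x1 ^+ 2 * x3 - 6 * x1 * x2 ^+ 2 + 6 * x1 * x2 *
      x3 - 6 * x1 * x3 ^+ 2 + 18 * x1 * u1 ^+ 2 - 6 * x1 * v1 ^+ 2 - 24 * x1 *
      v1 * v2 + 18 * x1 * w1 ^+ 2 + 24 * x1 * w1 * w2 - 6 * x2 ^+ 2 * x3 - 6 *
      x2 * x3 ^+ 2 - 24 * x2 * u1 * u2 - 6 * x2 * u2 ^+ 2 + 18 * x2 * v2 ^+ 2
      + 24 * x2 * w1 * w2 + 18 * x2 * w2 ^+ 2 + 18 * x3 * u1 ^+ 2 + 12 * x3 *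
      u1 * u2 - 6 * x3 * u2 ^+ 2 - 6 * x3 * v1 ^+ 2 + 12 * x3 * v1 * v2 + 18 *
      x3 * v2 ^+ 2 + 18 * x3 * w1 ^+ 2 + 36 * x3 * w1 * w2 + 18 * x3 * w2 ^+ 2
      - 24 * u1 * v1 * w2 - 24 * u2 * v1 * w1 - 24 * u2 * v1 * w2 - 24 * u2 *
      v2 * w1.

Lemma ddot4E (R : realType) (S T : tensor4 R) i j k l :
  ddot4 S T i j k l =
    S i j o0 o0 * T o0 o0 k l + S i j o0 o1 * T o0 o1 k l + S i j o0 o2 * T o0 o2 k l
  + (S i j o1 o0 * T o1 o0 k l + S i j o1 o1 * T o1 o1 k l + S i j o1 o2 * T o1 o2 k l)
  + (S i j o2 o0 * T o2 o0 k l + S i j o2 o1 * T o2 o1 k l + S i j o2 o2 * T o2 o2 k l).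
Proof. by rewrite /ddot4 !big_I3. Qed.

Lemma sq_trace_harm (R : realType) (x1 x2 x3 u1 u2 v1 v2 w1 w2 : R) :
  sq_trace (harm x1 x2 x3 u1 u2 v1 v2 w1 w2) = sym3
    (4 * x2 ^+ 2 + 2 * x2 * x3 + 4 * x3 ^+ 2 + 6 * u1 ^+ 2 + 4 * v1 ^+ 2 + 2 *
      v1 * v2 + 4 * v2 ^+ 2 + 6 * w1 ^+ 2 + 6 * w1 * w2 + 4 * w2 ^+ 2)
    (4 * x1 ^+ 2 + 2 * x1 * x3 + 4 * x3 ^+ 2 + 4 * u1 ^+ 2 + 2 * u1 * u2 + 4 *
      u2 ^+ 2 + 6 * v2 ^+ 2 + 4 * w1 ^+ 2 + 6 * w1 * w2 + 6 * w2 ^+ 2)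
    (4 * x1 ^+ 2 + 2 * x1 * x2 + 4 * x2 ^+ 2 + 6 * u1 ^+ 2 + 6 * u1 * u2 + 4 *
      u2 ^+ 2 + 4 * v1 ^+ 2 + 6 * v1 * v2 + 6 * v2 ^+ 2 + 6 * w1 ^+ 2 + 12 *
      w1 * w2 + 6 * w2 ^+ 2)
    (- 2 * x1 * u1 + 4 * x2 * u1 + x2 * u2 + 3 * x3 * u1 - x3 * u2 + 4 * v1 *
      w1 + 3 * v1 * w2 - 3 * v2 * w1)
    (x1 * v1 + 4 * x1 * v2 - 2 * x2 * v2 - x3 * v1 + 3 * x3 * v2 - 3 * u1 * w2
      + 3 * u2 * w1 + 4 * u2 * w2)
    (- 3 * x1 * w1 - 4 * x1 * w2 - 4 * x2 * w1 - 3 * x2 * w2 + 2 * x3 * w1 + 2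
      * x3 * w2 + 4 * u1 * v1 + 7 * u1 * v2 + u2 * v1 + 4 * u2 * v2).
Proof.
apply/matrixP; do 2 apply: I3P; rewrite mxE big_I3 !ddot4E sym3E; eval_harm;
  ring.
Qed.

(** Replaces the triple product defining [d_3] by one contraction of [H] with [d_2], which keeps the
    later polynomial identities manageable. *)
Lemma cube_trace_harm (R : realType) (x1 x2 x3 u1 u2 v1 v2 w1 w2 : R) :
  cube_trace (harm x1 x2 x3 u1 u2 v1 v2 w1 w2) =
  2^-1 *: contract (harm x1 x2 x3 u1 u2 v1 v2 w1 w2)
            (sq_trace (harm x1 x2 x3 u1 u2 v1 v2 w1 w2))
  + (harm_cube_trace x1 x2 x3 u1 u2 v1 v2 w1 w2 / 3) *: 1%:M.
Proof.
rewrite sq_trace_harm contract_harm; apply/matrixP; do 2 apply: I3P.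
all: rewrite addmxE !scalemxE sym3E [1%:M _ _]mxE mxE.
all: rewrite big_I3 !ddot4E.
all: rewrite /harm_cube_trace /=; eval_harm.

all: by field.
Qed.

Lemma mulmx3E (R : realType) (a b : 'M[R]_3) i j :
  (a * b) i j = a i o0 * b o0 j + a i o1 * b o1 j + a i o2 * b o2 j.
Proof. by rewrite mxE big_I3. Qed.

Section Sym3.
Variables (R : realType) (a11 a22 a33 a23 a13 a12 b11 b22 b33 b23 b13 b12 : R).
Let a := sym3 a11 a22 a33 a23 a13 a12.
Let b := sym3 b11 b22 b33 b23 b13 b12.

Lemma sym3D : a + b = sym3 (a11 + b11) (a22 + b22) (a33 + b33)
  (a23 + b23) (a13 + b13) (a12 + b12).
Proof. by apply/matrixP; do 2 apply: I3P; rewrite addmxE !sym3E. Qed.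

Lemma sym3Z x : x *: a = sym3 (x * a11) (x * a22) (x * a33)
  (x * a23) (x * a13) (x * a12).
Proof. by apply/matrixP; do 2 apply: I3P; rewrite scalemxE !sym3E. Qed.

Lemma sym3_1 : 1%:M = sym3 1 1 1 0 0 0 :> 'M[R]_3.
Proof. by apply/matrixP; do 2 apply: I3P; rewrite !sym3E mxE. Qed.

Lemma sym3_tr : \tr a = a11 + a22 + a33.
Proof. by rewrite /mxtrace big_I3 !sym3E. Qed.

Lemma sym3_sqr : a ^+ 2 = sym3
  (a11 * a11 + a12 * a12 + a13 * a13) (a12 * a12 + a22 * a22 + a23 * a23)
  (a13 * a13 + a23 * a23 + a33 * a33) (a12 * a13 + a22 * a23 + a23 * a33)
  (a11 * a13 + a12 * a23 + a13 * a33) (a11 * a12 + a12 * a22 + a13 * a23).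
Proof.
by apply/matrixP; do 2 apply: I3P; rewrite expr2 mulmx3E !sym3E; ring.
Qed.

Lemma sym3_tr_mul : \tr (a * b) =
  a11 * b11 + a22 * b22 + a33 * b33 + 2 * (a23 * b23 + a13 * b13 + a12 * b12).
Proof. by rewrite /mxtrace big_I3 !mulmx3E !sym3E; ring. Qed.

Lemma sym3_ddot : ddot a b =
  a11 * b11 + a22 * b22 + a33 * b33 + 2 * (a23 * b23 + a13 * b13 + a12 * b12).
Proof. by rewrite /ddot !big_I3 !sym3E; ring. Qed.

Lemma sym3_anticomm : a * b + b * a = sym3
  (2 * (a11 * b11 + a12 * b12 + a13 * b13)) (2 * (a12 * b12 + a22 * b22 + a23 * b23))
  (2 * (a13 * b13 + a23 * b23 + a33 * b33))
  (a12 * b13 + a22 * b23 + a23 * b33 + (b12 * a13 + b22 * a23 + b23 * a33))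
  (a11 * b13 + a12 * b23 + a13 * b33 + (b11 * a13 + b12 * a23 + b13 * a33))
  (a11 * b12 + a12 * b22 + a13 * b23 + (b11 * a12 + b12 * a22 + b13 * a23)).
Proof.
by apply/matrixP; do 2 apply: I3P; rewrite addmxE !mulmx3E !sym3E; ring.
Qed.

End Sym3.

(** * Polynomial relations between contractions of [H] and traces of [d_2], [d_3] *)

(* The coefficients below were found by interpolation on random harmonic tensors. *)
Section Syzygies.
Variables (R : realType) (H : tensor4 R).
Hypothesis hH : harmonic4 H.
Let a := sq_trace H.
Let b := cube_trace H.

Ltac to_scalars := rewrite /a /b (harmP hH) cube_trace_harm sq_trace_harm;
  rewrite ?contract_harm sym3_1 !sym3Z sym3D ?sym3_sqr ?contract_harm.

Lemma contract_sq_trace : contract H a = 2 *: dev b.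
Proof.
rewrite /a /b (harmP hH) cube_trace_harm; set h := contract _ _.
set j := harm_cube_trace _ _ _ _ _ _ _ _ _.
have h0 : \tr h = 0.
  by rewrite /h sq_trace_harm contract_harm sym3_tr; ring.
rewrite /dev mxtraceD !mxtraceZ h0 mxtrace1 mulr0 add0r scalerBr scalerDr !scalerA.
by rewrite divff ?pnatr_eq0 // scale1r divfK ?pnatr_eq0 // addrK.
Qed.

(** The trace of [d_3^2] is not among the 21 invariants; this relation recovers it. *)
Lemma tr_cube_trace_sqr : \tr (b ^+ 2) =
  4 / 9 * \tr (a ^+ 3) - 11 / 30 * \tr (a ^+ 2) * \tr a
  + 19 / 54 * \tr b ^+ 2 + 13 / 180 * \tr a ^+ 3.
Proof.
rewrite [a ^+ 3]exprSr. to_scalars.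
rewrite !(sym3_tr_mul, sym3_tr) /harm_cube_trace.
by field.
Qed.

(** In this relation and the next two, the left side is linear in [H] once [a] and [b] are fixed,
    and the right side depends on [a] and [b] alone. *)
Lemma cube_contract_cube : ddot b (contract H b) =
  \tr (a ^+ 2 * b) - 11 / 20 * \tr (a * b) * \tr a
  - 17 / 60 * \tr (a ^+ 2) * \tr b + 1 / 6 * \tr b * \tr a ^+ 2.
Proof.
to_scalars; rewrite !(sym3_tr_mul, sym3_tr, sym3_ddot) /harm_cube_trace.
by field.
Qed.

Lemma sqr_contract_cube : ddot (a ^+ 2) (contract H b) =
  3 / 4 * \tr (a * b ^+ 2) + 41 / 72 * \tr (a ^+ 3) * \tr a
  - 11 / 24 * \tr (a * b) * \tr b + 1 / 10 * \tr (a ^+ 2) ^+ 2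
  - 133 / 240 * \tr (a ^+ 2) * \tr a ^+ 2
  + 19 / 216 * \tr b ^+ 2 * \tr a + 79 / 720 * \tr a ^+ 4.
Proof.
rewrite [a ^+ 3]exprSr; to_scalars.
rewrite !(sym3_tr_mul, sym3_tr, sym3_ddot) /harm_cube_trace.
by field.
Qed.

Lemma sqr_contract_sqr : ddot (a ^+ 2) (contract H (a ^+ 2)) =
  15 / 4 * \tr (b ^+ 3) + 5 / 2 * \tr (a ^+ 2 * b) * \tr a
  - 197 / 108 * \tr (a ^+ 3) * \tr b - 25 / 32 * \tr (a * b) * \tr a ^+ 2
  + 203 / 288 * \tr (a ^+ 2) * \tr b * \tr a
  - 625 / 1296 * \tr b ^+ 3 - 41 / 864 * \tr b * \tr a ^+ 3.
Proof.
rewrite [a ^+ 3]exprSr [b ^+ 3]exprSr; to_scalars.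
rewrite !(sym3_tr_mul, sym3_tr, sym3_ddot) /harm_cube_trace.
by field.
Qed.

End Syzygies.

(** With explicit multipliers, an equality modulo seven equations becomes an identity that [field]
    can check. *)
Lemma linear_comb7 (R : pzRingType) (k1 k2 k3 k4 k5 k6 k7 : R)
    (u1 u2 u3 u4 u5 u6 u7 v1 v2 v3 v4 v5 v6 v7 w w' : R) :
  u1 = v1 -> u2 = v2 -> u3 = v3 -> u4 = v4 -> u5 = v5 -> u6 = v6 -> u7 = v7 ->
  w - w' = k1 * (u1 - v1) + k2 * (u2 - v2) + k3 * (u3 - v3) + k4 * (u4 - v4)
    + k5 * (u5 - v5) + k6 * (u6 - v6) + k7 * (u7 - v7) -> w = w'.
Proof.
by do 7 move=> ->; rewrite !subrr !mulr0 !addr0 => /subr0_eq.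
Qed.

(* [tr d_3 * H] is a quadratic expression in [H] with coefficients in [d_2]; only
   the components that a diagonal [d_2] sees are needed. *)
Lemma harm_cube_trace_mul (R : realType) (x1 x2 x3 u1 u2 v1 v2 w1 w2
    a11 a22 a33 a23 a13 a12 : R) (j := harm_cube_trace x1 x2 x3 u1 u2 v1 v2 w1 w2) :
  sq_trace (harm x1 x2 x3 u1 u2 v1 v2 w1 w2) = sym3 a11 a22 a33 a23 a13 a12 ->
  [/\ j * x1 =
    a11 * (3 * x1 * x2 - 3 * x1 * x3 + 12 * x2 ^+ 2 - 3 * x2 * x3 + 6 * u1 *
       u2 + 12 * v1 ^+ 2 + 18 * v1 * v2) / 2
    + a22 * (- 6 * x1 ^+ 2 - 9 * x1 * x2 + 3 * x1 * x3 - 12 * x2 ^+ 2 + 3 * x2 *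
       x3 - 6 * u2 ^+ 2 - 12 * v1 ^+ 2 - 24 * v1 * v2 - 18 * v2 ^+ 2) / 2
    + a33 * (5 * x1 ^+ 2 + x1 * x2 - 4 * x2 ^+ 2 - 3 * u1 * u2 + 5 * u2 ^+ 2 - 4
       * v1 ^+ 2 - 3 * v1 * v2 + 9 * v2 ^+ 2)
    + a23 * (- 2 * x1 * u1 + 16 * x2 * u1 + 10 * x2 * u2 + 6 * x3 * u1 - 10 * x3
       * u2 + 16 * v1 * w1 + 18 * v1 * w2 + 18 * v2 * w2)
    + a13 * (3 * x1 * v1 + 6 * x2 * v2 + 9 * x3 * v1 + 21 * x3 * v2 + 3 * u1 *
       w2 - 15 * u2 * w1) / 2
    + a12 * (3 * x1 * w1 - 12 * x2 * w1 - 21 * x2 * w2 - 6 * x3 * w1 - 6 * x3 *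
       w2 + 12 * u1 * v1 - 3 * u1 * v2 + 15 * u2 * v1) / 2
    + (- 9 * a11 ^+ 2 + 18 * a11 * a22 + 3 * a11 * a33 - 9 * a22 ^+ 2 + 3
       * a22 * a33 - 4 * a33 ^+ 2 - 56 * a23 ^+ 2 - 6 * a13 ^+ 2 - 6 * a12
       ^+ 2) / 20,
    j * x2 =
    a11 * (- 12 * x1 ^+ 2 - 9 * x1 * x2 + 3 * x1 * x3 - 6 * x2 ^+ 2 + 3 * x2 *
       x3 - 18 * u1 ^+ 2 - 24 * u1 * u2 - 12 * u2 ^+ 2 - 6 * v1 ^+ 2) / 2
    + a22 * (12 * x1 ^+ 2 + 3 * x1 * x2 - 3 * x1 * x3 - 3 * x2 * x3 + 18 * u1 *
       u2 + 12 * u2 ^+ 2 + 6 * v1 * v2) / 2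
    + a33 * (- 4 * x1 ^+ 2 + x1 * x2 + 5 * x2 ^+ 2 + 9 * u1 ^+ 2 - 3 * u1 * u2 -
       4 * u2 ^+ 2 + 5 * v1 ^+ 2 - 3 * v1 * v2)
    + a23 * (2 * x1 * u1 + 2 * x2 * u1 + 2 * x2 * u2 + 12 * x3 * u1 + 4 * x3 *
       u2 + 2 * v1 * w1 - 6 * v1 * w2)
    + a13 * (6 * x1 * v1 + 6 * x2 * v2 - 6 * x3 * v1 - 6 * x3 * v2 + 18 * u1 *
       w1 + 12 * u1 * w2 + 6 * u2 * w1)
    + a12 * (- 6 * x1 * w1 + 6 * x2 * w1 + 6 * x2 * w2 - 6 * x3 * w1 - 6 * x3 *
       w2 - 6 * u1 * v1 - 12 * u1 * v2 + 6 * u2 * v1)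
    + (- 9 * a11 ^+ 2 + 18 * a11 * a22 + 3 * a11 * a33 - 9 * a22 ^+ 2 + 3
       * a22 * a33 - 4 * a33 ^+ 2 - 16 * a23 ^+ 2 + 24 * a13 ^+ 2 + 24 *
       a12 ^+ 2) / 20
  & j * x3 =
    a11 * (- 6 * x2 ^+ 2 + 3 * x3 ^+ 2 - 3 * u1 ^+ 2 - 6 * v1 ^+ 2 - 6 * v1 *
       v2 + 6 * v2 ^+ 2 - 3 * w1 ^+ 2 + 6 * w2 ^+ 2)
    + a22 * (3 * x1 * x3 + 9 * x3 ^+ 2 + 12 * u1 ^+ 2 - 3 * u1 * u2 + 6 * v2 ^+
       2 + 12 * w1 ^+ 2 + 9 * w1 * w2 + 6 * w2 ^+ 2)
    + a33 * (- 3 * x1 * x3 - 3 * x2 * x3 - 12 * x3 ^+ 2 - 12 * u1 ^+ 2 + 3 * u1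
       * u2 + 3 * v1 * v2 - 12 * v2 ^+ 2 - 12 * w1 ^+ 2 - 12 * w1 * w2 -
       12 * w2 ^+ 2)
    + a23 * (6 * x1 * u1 - 6 * x2 * u2 - 6 * x3 * u1 - 6 * v1 * w2 + 12 * v2 *
       w1)
    + a13 * (- 6 * x1 * v1 + 6 * x2 * v2 - 6 * x3 * v2 + 12 * u1 * w2 - 6 * u2 *
       w1)
    + a12 * (6 * x1 * w1 + 6 * x2 * w2 - 6 * x3 * w1 - 6 * x3 * w2 - 12 * u1 *
       v2 - 6 * u2 * v1)
    + (3 * a11 ^+ 2 - 21 * a11 * a22 + 24 * a11 * a33 - 12 * a22 ^+ 2 + 24
       * a22 * a33 - 12 * a33 ^+ 2 + 12 * a23 ^+ 2 + 12 * a13 ^+ 2 + 12 *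
       a12 ^+ 2) / 10].
Proof.
move=> e; rewrite /j /harm_cube_trace.
have := congr1 (fun m : 'M_3 => (m o0 o0, m o1 o1, m o2 o2, m o1 o2, m o0 o2, m o0 o1)) e.
rewrite sq_trace_harm !sym3E => -[<- <- <- <- <- <-].
by split; field.
Qed.

(* The certificate expresses the difference of both sides through the relation
   for [tr b^2], the three relations of [harm_cube_trace_mul] and the diagonal
   entries of the equation for [sq_trace H]. *)
Lemma anticomm_contract_sqr (R : realType) (H : tensor4 R) a1 a2 a3
    (a := sq_trace H) (b := cube_trace H) :
  harmonic4 H -> sq_trace H = sym3 a1 a2 a3 0 0 0 ->
  ddot (a * b + b * a) (contract H (a ^+ 2)) =
  \tr (a ^+ 2 * b ^+ 2) + 21 / 8 * \tr (a * b ^+ 2) * \tr a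
  + 1 / 2 * \tr (a ^+ 2 * b) * \tr b + 2 / 45 * \tr (a ^+ 3) * \tr (a ^+ 2)
  - 1 / 720 * \tr (a ^+ 3) * \tr a ^+ 2
  - 77 / 48 * \tr (a * b) * \tr b * \tr a
  + 1 / 30 * \tr (a ^+ 2) ^+ 2 * \tr a - 7 / 27 * \tr (a ^+ 2) * \tr b ^+ 2
  - 73 / 1440 * \tr (a ^+ 2) * \tr a ^+ 3
  + 101 / 432 * \tr b ^+ 2 * \tr a ^+ 2 + 17 / 1440 * \tr a ^+ 5.
Proof.
move=> hH; have := tr_cube_trace_sqr hH; rewrite /a /b (harmP hH).
move: (H _ _ _ _) (H _ _ _ _) (H _ _ _ _) (H _ _ _ _) (H _ _ _ _) (H _ _ _ _)
  (H _ _ _ _) (H _ _ _ _) (H _ _ _ _) => w2 w1 v2 v1 u2 u1 x3 x2 x1.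
move=> + e; have [] := harm_cube_trace_mul e.
rewrite cube_trace_harm e contract_harm sym3_1 !sym3Z sym3D [_ ^+ 3]exprSr !sym3_sqr.
rewrite sym3_anticomm contract_harm !(sym3_tr_mul, sym3_tr, sym3_ddot).
have := congr1 (fun m : 'M_3 => (m o0 o0, m o1 o1, m o2 o2)) e.
rewrite sq_trace_harm !sym3E => -[r1 r2 r3].
(* From here [tr d_3] is a variable [j], tied to the components of [H] only through [q1], [q2], [q3]
   and [t]. *)
move: (harm_cube_trace _ _ _ _ _ _ _ _ _) => j q1 q2 q3 t.
apply: (linear_comb7
    (k1 :=
      (a1 ^+ 2 - 2 * a1 * a2 - 2 * a1 * a3 + a2 ^+ 2 - 2 * a2 * a3 + a3 ^+
       2) / 2)
    (k2 :=
      (7 * a1 * a2 ^+ 2 - 14 * a1 * a2 * a3 + 7 * a1 * a3 ^+ 2 - a2 ^+ 3 +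
       a2 ^+ 2 * a3 + a2 * a3 ^+ 2 - a3 ^+ 3) / 96)
    (k3 :=
      (- a1 ^+ 3 + 7 * a1 ^+ 2 * a2 + a1 ^+ 2 * a3 - 14 * a1 * a2 * a3 +
       a1 * a3 ^+ 2 + 7 * a2 * a3 ^+ 2 - a3 ^+ 3) / 96)
    (k4 :=
      (- a1 ^+ 3 + a1 ^+ 2 * a2 + 7 * a1 ^+ 2 * a3 + a1 * a2 ^+ 2 - 14 *
       a1 * a2 * a3 - a2 ^+ 3 + 7 * a2 ^+ 2 * a3) / 96)
    (k5 :=
      (- 5 * a1 ^+ 4 + 24 * a1 ^+ 3 * a2 + 19 * a1 ^+ 3 * a3 - 42 * a1 ^+
       2 * a2 ^+ 2 + a1 ^+ 2 * a2 * a3 - 48 * a1 ^+ 2 * a3 ^+ 2 + 24 * a1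
       * a2 ^+ 3 - 7 * a1 * a2 ^+ 2 * a3 + 36 * a1 * a2 * a3 ^+ 2 + 16 *
       a1 * a3 ^+ 3 - a2 ^+ 4 - 13 * a2 ^+ 3 * a3 + 12 * a2 ^+ 2 * a3 ^+ 2
       - 16 * a2 * a3 ^+ 3) / 128)
    (k6 :=
      (- a1 ^+ 4 + 22 * a1 ^+ 3 * a2 - 13 * a1 ^+ 3 * a3 - 40 * a1 ^+ 2 *
       a2 ^+ 2 + 7 * a1 ^+ 2 * a2 * a3 + 12 * a1 ^+ 2 * a3 ^+ 2 + 26 * a1
       * a2 ^+ 3 - 27 * a1 * a2 ^+ 2 * a3 + 36 * a1 * a2 * a3 ^+ 2 - 16 *
       a1 * a3 ^+ 3 - 7 * a2 ^+ 4 + 33 * a2 ^+ 3 * a3 - 48 * a2 ^+ 2 * a3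
       ^+ 2 + 16 * a2 * a3 ^+ 3) / 128)
    (k7 :=
      (9 * a1 ^+ 4 - 114 * a1 ^+ 3 * a2 + 37 * a1 ^+ 3 * a3 + 138 * a1 ^+
       2 * a2 ^+ 2 + 89 * a1 ^+ 2 * a2 * a3 - 70 * a1 ^+ 2 * a3 ^+ 2 - 114
       * a1 * a2 ^+ 3 + 89 * a1 * a2 ^+ 2 * a3 - 164 * a1 * a2 * a3 ^+ 2 +
       70 * a1 * a3 ^+ 3 + 9 * a2 ^+ 4 + 37 * a2 ^+ 3 * a3 - 70 * a2 ^+ 2
       * a3 ^+ 2 + 70 * a2 * a3 ^+ 3 - 16 * a3 ^+ 4) / 384)
  t q1 q2 q3 r1 r2 r3).
by field.
Qed.

(** * Uniqueness in a frame where [d_2] is diagonal *)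

Lemma cramer3 (R : fieldType) (a1 a2 a3 b1 b2 b3 c1 c2 c3 x y z : R) :
  a1 * (b2 * c3 - b3 * c2) + a2 * (b3 * c1 - b1 * c3) + a3 * (b1 * c2 - b2 * c1) != 0 ->
  a1 * x + a2 * y + a3 * z = 0 -> b1 * x + b2 * y + b3 * z = 0 ->
  c1 * x + c2 * y + c3 * z = 0 -> [/\ x = 0, y = 0 & z = 0].
Proof.
set D := (X in X != 0) => D0 e1 e2 e3.
(* Each unknown times the determinant is the combination of the equations weighted by a row of the
   adjugate matrix. *)
have Dx : D * x = (b2 * c3 - b3 * c2) * (a1 * x + a2 * y + a3 * z)
    + (a3 * c2 - a2 * c3) * (b1 * x + b2 * y + b3 * z)
    + (a2 * b3 - a3 * b2) * (c1 * x + c2 * y + c3 * z) by rewrite /D; ring.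
have Dy : D * y = (b3 * c1 - b1 * c3) * (a1 * x + a2 * y + a3 * z)
    + (a1 * c3 - a3 * c1) * (b1 * x + b2 * y + b3 * z)
    + (a3 * b1 - a1 * b3) * (c1 * x + c2 * y + c3 * z) by rewrite /D; ring.
have Dz : D * z = (b1 * c2 - b2 * c1) * (a1 * x + a2 * y + a3 * z)
    + (a2 * c1 - a1 * c2) * (b1 * x + b2 * y + b3 * z)
    + (a1 * b2 - a2 * b1) * (c1 * x + c2 * y + c3 * z) by rewrite /D; ring.
by move: Dx Dy Dz; rewrite e1 e2 e3 !mulr0 !addr0; do 3 (move=> /eqP;
  rewrite mulf_eq0 (negPf D0) => /eqP ?).
Qed.

Lemma vandermonde3 (R : fieldType) (a1 a2 a3 x y z : R) :
  a1 != a2 -> a2 != a3 -> a1 != a3 -> x + y + z = 0 ->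
  a1 * x + a2 * y + a3 * z = 0 -> a1 ^+ 2 * x + a2 ^+ 2 * y + a3 ^+ 2 * z = 0 ->
  [/\ x = 0, y = 0 & z = 0].
Proof.
move=> n12 n23 n13 e0; apply: (cramer3 (a1 := 1) (a2 := 1) (a3 := 1));
  last by rewrite !mul1r.
rewrite (_ : _ + _ = (a2 - a1) * (a3 - a1) * (a3 - a2)); last by ring.
by rewrite !mulf_neq0 // subr_eq0 eq_sym.
Qed.

Lemma sum_sqr_eq0 (R : realDomainType) (x y z : R) :
  x ^+ 2 + y ^+ 2 + z ^+ 2 = 0 -> [/\ x == 0, y == 0 & z == 0].
Proof.
move=> /eqP; rewrite !paddr_eq0 ?addr_ge0 ?sqr_ge0 // !sqrf_eq0.
by move=> /andP[/andP[-> ->] ->].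
Qed.

Lemma contract_linear (R : realType) (S T : tensor4 R) m x y :
  contract (fun i j k l => x * S i j k l + y * T i j k l) m =
  x *: contract S m + y *: contract T m.
Proof.
apply/matrixP => i j; rewrite addmxE !scalemxE !mxE !mulr_sumr -big_split.
apply: eq_bigr => k _; rewrite !mulr_sumr -big_split; apply: eq_bigr => l _ /=; ring.
Qed.

Lemma ddot_linear (R : realType) (m a b : 'M[R]_3) x y :
  ddot m (x *: a + y *: b) = x * ddot m a + y * ddot m b.
Proof.
rewrite /ddot !mulr_sumr -big_split; apply: eq_bigr => i _ /=.
rewrite !mulr_sumr -big_split; apply: eq_bigr => j _ /=.
by rewrite addmxE !scalemxE; ring.
Qed.

Lemma ddotC (R : realType) (a b : 'M[R]_3) : ddot a b = ddot b a.
Proof. by apply: eq_bigr => i _; apply: eq_bigr => j _; rewrite mulrC. Qed.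

Section Frame.
Variables (R : realType) (a1 a2 a3 b11 b22 b33 b23 b13 b12 : R).
Hypotheses (n12 : a1 != a2) (n23 : a2 != a3) (n13 : a1 != a3).
(** At least two off-diagonal entries of [b] are nonzero: the consequence of triclinicity used when
    [a] is diagonal. *)
Hypothesis two_nonzero : (b13 * b12) ^+ 2 + (b23 * b12) ^+ 2 + (b23 * b13) ^+ 2 != 0.
Let a := sym3 a1 a2 a3 0 0 0.
Let b := sym3 b11 b22 b33 b23 b13 b12.

Let n12' : a1 - a2 != 0. Proof. by rewrite subr_eq0. Qed.
Let n23' : a2 - a3 != 0. Proof. by rewrite subr_eq0. Qed.
Let n31' : a3 - a1 != 0. Proof. by rewrite subr_eq0 eq_sym. Qed.

Lemma harmonic_eq0 (K : tensor4 R) : harmonic4 K -> contract K a = 0 ->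
  ddot (a ^+ 2) (contract K (a ^+ 2)) = 0 -> ddot (a ^+ 2) (contract K b) = 0 ->
  ddot (a * b + b * a) (contract K (a ^+ 2)) = 0 -> ddot b (contract K b) = 0 ->
  forall i j k l, K i j k l = 0.
Proof.
move=> /harmP ->.
move: (K _ _ _ _) (K _ _ _ _) (K _ _ _ _) (K _ _ _ _) (K _ _ _ _) (K _ _ _ _)
  (K _ _ _ _) (K _ _ _ _) (K _ _ _ _) => w2 w1 v2 v1 u2 u1 x3 x2 x1.
rewrite sym3_sqr sym3_anticomm !contract_harm !sym3_ddot => e.
have {}e i j := congr1 (fun m : 'M_3 => m i j) e.
have := (e o0 o0, e o1 o1, e o1 o2, e o0 o2, e o0 o1); rewrite !mxE {e}.
rewrite /pick3 /= => -[[[[e11 e22] e23] e13] e12].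
(* Each off-diagonal entry of [K : a = 0] makes a pair such as [(u1, u2)] orthogonal to
   [(a1 - a3, a2 - a3)], hence a multiple of [(a2 - a3, a3 - a1)]. *)
have [s1 [-> ->]] : exists s, u1 = s * (a2 - a3) /\ u2 = s * (a3 - a1).
  exists (u1 / (a2 - a3)); split; first by rewrite divfK.
  apply: (mulIf n23'); transitivity (u1 * (a3 - a1)); last by field.
  by apply: subr0_eq; rewrite -e23; ring.
have [s2 [-> ->]] : exists s, v1 = s * (a2 - a3) /\ v2 = s * (a3 - a1).
  exists (v1 / (a2 - a3)); split; first by rewrite divfK.
  apply: (mulIf n23'); transitivity (v1 * (a3 - a1)); last by field.
  by apply: subr0_eq; rewrite -e13; ring.
have [s3 [-> ->]] : exists s, w1 = s * (a2 - a3) /\ w2 = s * (a3 - a1).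
  exists (w1 / (a2 - a3)); split; first by rewrite divfK.
  apply: (mulIf n23'); transitivity (w1 * (a3 - a1)); last by field.
  by apply: subr0_eq; rewrite -e12; ring.
(* The diagonal entries say that [x1 (a2 - a3)], [x2 (a3 - a1)] and [x3 (a1 - a2)] agree; [t] is
   their common value. *)
have [t [-> -> ->]] : exists t,
    [/\ x1 = t / (a2 - a3), x2 = t / (a3 - a1) & x3 = t / (a1 - a2)].
  exists (x3 * (a1 - a2)); split; last by rewrite mulfK.
    apply: (mulIf n23'); rewrite divfK //.
    by apply/eqP; rewrite -subr_eq0 -oppr_eq0 -e22; apply/eqP; ring.
  apply: (mulIf n31'); rewrite divfK //.
  by apply/eqP; rewrite -subr_eq0 -e11; apply/eqP; ring.
clear e11 e22 e23 e13 e12.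
(* The contraction [a^2 : K : a^2] is [t] times the Vandermonde product of the eigenvalues. *)
move=> e9; have {e9} -> : t = 0.
  have : t * ((a1 - a2) * (a2 - a3) * (a3 - a1)) = 0.
    by rewrite -e9; field; rewrite n12' n23' n31'.
  by move/eqP; rewrite !mulf_eq0 !(negPf n12', negPf n23', negPf n31') !orbF => /eqP.
rewrite !mul0r => e8 e10 e7.
have D0 : (a1 - a2) * (a2 - a3) * (a3 - a1) != 0 by rewrite !mulf_neq0.
have f8 : b23 * s1 + b13 * s2 + b12 * s3 = 0.
  by apply: (mulfI D0); rewrite mulr0 -[RHS](mulr0 (- 2^-1)) -e8; field.
have f10 : (a2 + a3) * b23 * s1 + (a1 + a3) * b13 * s2 + (a1 + a2) * b12 * s3 = 0.
  by apply: (mulfI D0); rewrite mulr0 -[RHS](mulr0 (- 2^-1)) -e10; field.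
(* In [b : K : b], the terms containing the diagonal of [b] are a multiple of the left side of [f8]
   and drop out. *)
have f7 : (a2 - a3) * (b13 * b12) * s1 + (a3 - a1) * (b23 * b12) * s2
    + (a1 - a2) * (b23 * b13) * s3 = 0.
  transitivity (8^-1 * (0 - 4 * (b11 * (a2 - a3) + b22 * (a3 - a1) + b33 * (a1 - a2))
    * (b23 * s1 + b13 * s2 + b12 * s3))).
    by rewrite -e7; field.
  by rewrite f8 !mulr0 subrr mulr0.
(* The coefficient row of [f7] is the cross product of those of [f8] and [f10], so the determinant
   of the system is its squared norm. *)
have det : ((a2 - a3) * (b13 * b12)) ^+ 2 + ((a3 - a1) * (b23 * b12)) ^+ 2
    + ((a1 - a2) * (b23 * b13)) ^+ 2 != 0.
  move: two_nonzero; apply: contra => /eqP /sum_sqr_eq0.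
  rewrite !mulf_eq0 !(negPf n12', negPf n23', negPf n31') /=.
  by case=> /orP[] /eqP -> /orP[] /eqP -> /orP[] /eqP ->;
    rewrite !(mul0r, mulr0) expr2 mul0r !addr0.
have [-> -> ->] : [/\ s1 = 0, s2 = 0 & s3 = 0].
  apply: (cramer3 _ f8 f10 f7); rewrite [X in X != 0](_ : _ = ((a2 - a3) * (b13 * b12)) ^+ 2
   + ((a3 - a1) * (b23 * b12)) ^+ 2 + ((a1 - a2) * (b23 * b13)) ^+ 2) //; ring.
by rewrite !mul0r; do 4 apply: I3P; eval_harm; ring.
Qed.

Lemma bracket_sqr : bracket a b ^+ 2 = sym3
  (- ((a1 - a2) * b12) ^+ 2 - ((a3 - a1) * b13) ^+ 2)
  (- ((a1 - a2) * b12) ^+ 2 - ((a2 - a3) * b23) ^+ 2)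
  (- ((a3 - a1) * b13) ^+ 2 - ((a2 - a3) * b23) ^+ 2)
  ((a1 - a2) * (a3 - a1) * (b13 * b12)) ((a1 - a2) * (a2 - a3) * (b23 * b12))
  ((a2 - a3) * (a3 - a1) * (b23 * b13)).
Proof.
apply/matrixP; do 2 apply: I3P;
  by rewrite expr2 mulmx3E /bracket !(addmxE, oppmxE) !mulmx3E !sym3E; ring.
Qed.

(** Products with [q], [a], [a^2] see only the diagonal of [m], which vanishes by Vandermonde. The
    other three give a system for the off-diagonal entries, whose determinant is the Vandermonde
    product times the sum of squares in [two_nonzero]. *)
Lemma deviator_eq0 (m : 'M[R]_3) : m^T = m -> \tr m = 0 -> ddot m a = 0 ->
  ddot m b = 0 -> ddot m (a ^+ 2) = 0 -> ddot m (a * b + b * a) = 0 ->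
  ddot m (bracket a b ^+ 2) = 0 -> m = 0.
Proof.
move=> /sym3P ->; move: (m _ _) (m _ _) (m _ _) (m _ _) (m _ _) (m _ _).
move=> m12 m13 m23 m33 m22 m11.
rewrite bracket_sqr sym3_sqr sym3_anticomm !sym3_ddot sym3_tr => e0 e1 eb e2 eab ec.
have [z1 z2 z3] : [/\ m11 = 0, m22 = 0 & m33 = 0].
  apply: (vandermonde3 n12 n23 n13 e0); first by rewrite -e1; ring.
  by rewrite -e2; ring.
move: eb eab ec; rewrite z1 z2 z3 => eb eab ec.
have [-> -> ->] : [/\ m23 = 0, m13 = 0 & m12 = 0].
  apply: (@cramer3 _ b23 b13 b12 ((a2 + a3) * b23) ((a1 + a3) * b13) ((a1 + a2) * b12)
    ((a1 - a2) * (a3 - a1) * (b13 * b12)) ((a1 - a2) * (a2 - a3) * (b23 * b12))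
    ((a2 - a3) * (a3 - a1) * (b23 * b13))).
  - rewrite [X in X != 0](_ : _ = ((a1 - a2) * (a2 - a3) * (a3 - a1)) *
      ((b13 * b12) ^+ 2 + (b23 * b12) ^+ 2 + (b23 * b13) ^+ 2)); last by ring.
    by rewrite !mulf_neq0.
  - by rewrite -[RHS](mulr0 2^-1) -eb; field.
  - by rewrite -[RHS](mulr0 2^-1) -eab; field.
  - by rewrite -[RHS](mulr0 2^-1) -ec; field.
by apply/matrixP; do 2 apply: I3P; rewrite sym3E mxE.
Qed.

End Frame.

Section Uniqueness.
Variables (R : realType) (a1 a2 a3 b11 b22 b33 b23 b13 b12 : R).
Hypotheses (n12 : a1 != a2) (n23 : a2 != a3) (n13 : a1 != a3).
Hypothesis two_nonzero : (b13 * b12) ^+ 2 + (b23 * b12) ^+ 2 + (b23 * b13) ^+ 2 != 0.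
Let a := sym3 a1 a2 a3 0 0 0.
Let b := sym3 b11 b22 b33 b23 b13 b12.

(** All contractions required by [harmonic_eq0] are linear in the tensor and, by the relations
    above, are determined by [a] and [b]; they cancel on [H - K]. *)
Lemma harmonic_unique (H K : tensor4 R) : harmonic4 H -> harmonic4 K ->
  sq_trace H = a -> sq_trace K = a -> cube_trace H = b -> cube_trace K = b -> H = K.
Proof.
move=> hH hK aH aK bH bK.
pose D : tensor4 R := fun i j k l => 1 * H i j k l + (-1) * K i j k l.
have hD : harmonic4 D.
  split; last by rewrite /D tr12_linear hH.2 hK.2 !scaler0 addr0.
  move=> i j k l; rewrite /D; have [h1 h2 h3] := hH.1 i j k l.
  by have [k1 k2 k3] := hK.1 i j k l; rewrite -h1 -h2 -h3 -k1 -k2 -k3.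
have D0 i j k l : D i j k l = 0.
  apply: (harmonic_eq0 (b11 := b11) (b22 := b22) (b33 := b33) n12 n23 n13 two_nonzero hD);
    rewrite -/a -/b /D contract_linear.
  - by rewrite -{1}aH -aK !contract_sq_trace // bH bK scale1r scaleN1r subrr.
  - rewrite ddot_linear -{1 2}aH -{1 2}aK !sqr_contract_sqr // aH aK bH bK.
    by rewrite mul1r mulN1r subrr.
  - rewrite ddot_linear -{1}aH -{1}bH -{1}aK -{1}bK !sqr_contract_cube // aH aK bH bK.
    by rewrite mul1r mulN1r subrr.
  - have := anticomm_contract_sqr hH aH; have := anticomm_contract_sqr hK aK.
    by rewrite aH aK bH bK ddot_linear => -> ->; rewrite mul1r mulN1r subrr.
  - rewrite ddot_linear -{1 2}bH -{1 2}bK !cube_contract_cube // aH aK bH bK.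
    by rewrite mul1r mulN1r subrr.
by apply/tensor4P => i j k l; have := D0 i j k l; rewrite /D; lra.
Qed.

Lemma dev_unique (c d : 'M[R]_3) : c^T = c -> d^T = d -> \tr c = \tr d ->
  ddot (dev c) a = ddot (dev d) a -> ddot (dev c) b = ddot (dev d) b ->
  ddot (dev c) (a ^+ 2) = ddot (dev d) (a ^+ 2) ->
  ddot (dev c) (a * b + b * a) = ddot (dev d) (a * b + b * a) ->
  ddot (dev c) (bracket a b ^+ 2) = ddot (dev d) (bracket a b ^+ 2) -> c = d.
Proof.
move=> cs ds ct e1 e2 e3 e4 e5.
have tr0 m : \tr (dev m) = 0 :> R.
  by rewrite /dev linearB linearZ /= mxtrace1 divfK ?pnatr_eq0 // subrr.
have lin m : ddot (dev c) m = ddot (dev d) m -> ddot (dev c - dev d) m = 0.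
  rewrite ![ddot _ m]ddotC -[dev c - dev d]/(dev c + - dev d).
  rewrite -scaleN1r -[dev c in X in X = 0]scale1r.
  by rewrite ddot_linear => ->; rewrite mul1r mulN1r subrr.
have : dev c - dev d = 0.
  apply: (deviator_eq0 (b11 := b11) (b22 := b22) (b33 := b33)
    n12 n23 n13 two_nonzero); try exact: lin.
    by rewrite linearB /= !tr_dev cs ds.
  by rewrite linearB /= !tr0 subrr.
by move=> /subr0_eq; rewrite /dev ct; exact: addIr.
Qed.

Lemma ela_unique (E F : tensor4 R) : is_ela E -> is_ela F ->
  d2 E = a -> d2 F = a -> d3 E = b -> d3 F = b ->
  invariants E = invariants F -> E = F.
Proof.
move=> hE hF aE aF bE bF /(congr1 val) /=; rewrite aE aF bE bF.
case=> dt vt *; apply: ela_inj => //.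
- by apply: dev_unique; rewrite ?ela_tr12.
- by apply: dev_unique; rewrite ?ela_tr13.
by apply: harmonic_unique => //; exact: harmonic_part_harmonic.
Qed.

End Uniqueness.

(** * Recovering [d_3] up to a diagonal matrix of signs *)

Lemma sign_of_sqr (R : realDomainType) (x y : R) :
  x ^+ 2 = y ^+ 2 -> exists2 e, e ^+ 2 = 1 & y = e * x.
Proof.
move=> /eqP; rewrite eqf_sqr => /orP[] /eqP ->; first by exists 1; rewrite ?expr1n ?mul1r.
by exists (-1); rewrite ?sqrrN ?expr1n // mulN1r opprK.
Qed.

(* The three off-diagonal signs come from a diagonal sign matrix exactly when
   their product is 1, which is what the equality of the products says unless
   one of them vanishes. *)
Lemma diagonal_signs (R : realDomainType) (x y z x' y' z' : R) :
  x ^+ 2 = x' ^+ 2 -> y ^+ 2 = y' ^+ 2 -> z ^+ 2 = z' ^+ 2 ->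
  x * y * z = x' * y' * z' ->
  exists e1 e2 e3, [/\ e1 ^+ 2 = 1, e2 ^+ 2 = 1 & e3 ^+ 2 = 1] /\
    [/\ x' = e2 * e3 * x, y' = e1 * e3 * y & z' = e1 * e2 * z].
Proof.
move=> /sign_of_sqr[e e2 ->] /sign_of_sqr[f f2 ->] /sign_of_sqr[g g2 ->] exyz.
(* A vanishing entry has a free sign: with one diagonal sign set to 1, the other two are read off
   from the remaining entries. *)
have [x0|x0] := eqVneq x 0.
  exists 1, g, f; split; split; rewrite ?expr1n // ?mul1r // x0 !mulr0 //.
have [y0|y0] := eqVneq y 0.
  exists g, 1, e; split; split; rewrite ?expr1n // ?mul1r ?mulr1 // y0 !mulr0 //.
have [z0|z0] := eqVneq z 0.
  exists f, e, 1; split; split; rewrite ?expr1n // ?mul1r ?mulr1 // z0 !mulr0 //.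
have efg : e * f * g = 1.
  apply: (mulIf x0); apply: (mulIf y0); apply: (mulIf z0); rewrite mul1r exyz; ring.
(* Since [e * f * g = 1], the product of two of these witnesses, for instance
   [(e g)(e f) = e (e f g)], is the wanted sign. *)
exists (f * g), (e * g), (e * f); rewrite !exprMn e2 f2 g2 !mul1r; split=> //.
split.
- by transitivity (e * (e * f * g) * x); [rewrite efg mulr1 | ring].
- by transitivity (f * (e * f * g) * y); [rewrite efg mulr1 | ring].
- by transitivity (g * (e * f * g) * z); [rewrite efg mulr1 | ring].
Qed.

Lemma linear_comb0 (R : pzRingType) (k m u v w : R) :
  u = 0 -> v = 0 -> w = k * u + m * v -> w = 0.
Proof. by move=> -> -> ->; rewrite !mulr0 addr0. Qed.

Section Signs.
Variables (R : realType) (a1 a2 a3 b11 b22 b33 b23 b13 b12 c11 c22 c33 c23 c13 c12 : R).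
Hypotheses (n12 : a1 != a2) (n23 : a2 != a3) (n13 : a1 != a3).
Let a := sym3 a1 a2 a3 0 0 0.
Let b := sym3 b11 b22 b33 b23 b13 b12.
Let c := sym3 c11 c22 c33 c23 c13 c12.

Lemma sym3_conj_diag (e1 e2 e3 : R) :
  conj3 (sym3 e1 e2 e3 0 0 0) b = sym3 (e1 ^+ 2 * b11) (e2 ^+ 2 * b22) (e3 ^+ 2 * b33)
    (e2 * e3 * b23) (e1 * e3 * b13) (e1 * e2 * b12).
Proof.
by apply/matrixP; do 2 apply: I3P; rewrite conj3E !big_I3 !sym3E; ring.
Qed.

(** Traces linear in [b] fix its diagonal by Vandermonde, traces quadratic in [b] then fix the
    squares of the off-diagonal entries, and [\tr (b ^+ 3)] fixes their product. *)
Lemma same_traces_conj : \tr b = \tr c -> \tr (a * b) = \tr (a * c) ->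
  \tr (a ^+ 2 * b) = \tr (a ^+ 2 * c) -> \tr (b ^+ 2) = \tr (c ^+ 2) ->
  \tr (a * b ^+ 2) = \tr (a * c ^+ 2) -> \tr (a ^+ 2 * b ^+ 2) = \tr (a ^+ 2 * c ^+ 2) ->
  \tr (b ^+ 3) = \tr (c ^+ 3) ->
  exists e1 e2 e3, [/\ e1 ^+ 2 = 1, e2 ^+ 2 = 1 & e3 ^+ 2 = 1] /\
    c = conj3 (sym3 e1 e2 e3 0 0 0) b.
Proof.
rewrite [b ^+ 3]exprSr [c ^+ 3]exprSr /a /b /c !sym3_sqr !sym3_tr_mul !sym3_tr.
move=> t1 ta ta2 t2 tab ta2b t3.
have [] : [/\ b11 - c11 = 0, b22 - c22 = 0 & b33 - c33 = 0].
  apply: (vandermonde3 n12 n23 n13); apply/eqP.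
  - by rewrite -subr_eq0 in t1 *; lra.
  - lra.
  - lra.
move=> /subr0_eq e11 /subr0_eq e22 /subr0_eq e33; subst c11 c22 c33.
have [] : [/\ b23 ^+ 2 - c23 ^+ 2 = 0, b13 ^+ 2 - c13 ^+ 2 = 0 & b12 ^+ 2 - c12 ^+ 2 = 0].
  have e0 : b23 ^+ 2 - c23 ^+ 2 + (b13 ^+ 2 - c13 ^+ 2) + (b12 ^+ 2 - c12 ^+ 2) = 0.
    by lra.
  apply: (vandermonde3 n12 n23 n13) => //.
    (* In [\tr (a * b ^+ 2)] the square of [b23] has weight [a2 + a3]; subtracting from
       [a1 + a2 + a3] times [e0] leaves the Vandermonde weight [a1]. The quadratic case below is
       alike. *)
    move: tab => /eqP; rewrite -subr_eq0 => /eqP tab.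
    by apply: (linear_comb0 (k := a1 + a2 + a3) (m := -1) e0 tab); ring.
  move: ta2b => /eqP; rewrite -subr_eq0 => /eqP ta2b.
  by apply: (linear_comb0 (k := a1 ^+ 2 + a2 ^+ 2 + a3 ^+ 2) (m := -1) e0 ta2b); ring.
move=> e23 e13 e12; have [e1 [e2 [e3 [[s1 s2 s3] [f23 f13 f12]]]]] :
    exists e1 e2 e3, [/\ e1 ^+ 2 = 1, e2 ^+ 2 = 1 & e3 ^+ 2 = 1] /\
    [/\ c23 = e2 * e3 * b23, c13 = e1 * e3 * b13 & c12 = e1 * e2 * b12].
  apply: diagonal_signs; try exact: subr0_eq.
  (* Besides the cubes of the diagonal entries, [\tr (b ^+ 3)] consists of three times such terms
     and of [6 * b23 * b13 * b12]. *)
  have q0 : b11 * (b13 ^+ 2 - c13 ^+ 2 + (b12 ^+ 2 - c12 ^+ 2))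
    + b22 * (b23 ^+ 2 - c23 ^+ 2 + (b12 ^+ 2 - c12 ^+ 2))
    + b33 * (b23 ^+ 2 - c23 ^+ 2 + (b13 ^+ 2 - c13 ^+ 2)) = 0.
    by rewrite e23 e13 e12 !addr0 !mulr0 !addr0.
  move: t3 => /eqP; rewrite -subr_eq0 => /eqP t3; apply: subr0_eq.
  by apply: (linear_comb0 (k := - 2^-1) (m := 6^-1) q0 t3); field.
exists e1, e2, e3; split=> //.
by rewrite sym3_conj_diag s1 s2 s3 !mul1r f23 f13 f12.
Qed.

End Signs.

(** * Diagonalization, triclinicity in a diagonal frame, equality of spectra *)

Lemma unit_eigenvector (R : realType) (a : 'M[R]_3) x : eigenvalue a x ->
  exists2 u : 'rV_3, u *m a = x *: u & u *m u^T = 1%:M.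
Proof.
move=> /eigenvalueP[v va v0]; pose n := (v *m v^T) 0 0.
have nE : v *m v^T = n%:M by rewrite [LHS]mx11_scalar.
have n0 : 0 < n.
  have [i vi] : exists i, v 0 i != 0.
    by move/rV0Pn: v0.
  rewrite /n mxE (bigD1 i) //= ltr_pwDl ?sumr_ge0 // => [|j _]; rewrite mxE.
    by rewrite -expr2 exprn_even_gt0.
  by rewrite -expr2 sqr_ge0.
exists ((Num.sqrt n)^-1 *: v).
  by rewrite -scalemxAl va !scalerA mulrC.
rewrite linearZ /= -scalemxAl -scalemxAr nE scalerA -invfM -expr2 sqr_sqrtr ?ltW //.
by rewrite scale_scalar_mx mulVf ?gt_eqF.
Qed.

Lemma diagonalize (R : realType) (a : 'M[R]_3) x y z : a^T = a ->
  x != y -> y != z -> x != z -> eigenvalue a x -> eigenvalue a y -> eigenvalue a z ->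
  exists2 P, orthogonal_group P & conj3 P a = sym3 x y z 0 0 0.
Proof.
move=> asym xy yz xz /unit_eigenvector[u ua uu] /unit_eigenvector[v va vv]
  /unit_eigenvector[w wa ww].
have orth p q (s t : 'rV_3) : p != q -> s *m a = p *: s -> t *m a = q *: t -> s *m t^T = 0.
  move=> pq sa ta; apply/eqP; have : (p - q) *: (s *m t^T) = 0.
    rewrite scalerBl [p *: _]scalemxAl -sa -mulmxA -{1}asym -trmx_mul ta.
    by rewrite linearZ /= -scalemxAr subrr.
  by move/eqP; rewrite scaler_eq0 subr_eq0 (negPf pq).
(* The rows of [P] are the unit eigenvectors, so the entries of [P P^T] and [P a P^T] are their
   pairwise products. *)
pose f (i : 'I_3) := match nat_of_ord i with 0 => u | 1 => v | _ => w end%N.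
pose P := \matrix_(i < 3) f i.
have PE i j : (P *m P^T) i j = (f i *m (f j)^T) 0 0.
  by rewrite !mxE; apply: eq_bigr => k _; rewrite !mxE.
have aE i j : conj3 P a i j = (f i *m a *m (f j)^T) 0 0.
  rewrite /conj3 !mxE; apply: eq_bigr => k _; rewrite !mxE; congr (_ * _).
  by apply: eq_bigr => m _; rewrite !mxE.
have uv := orth _ _ _ _ xy ua va; have vw := orth _ _ _ _ yz va wa.
have uw := orth _ _ _ _ xz ua wa.
have tr0 (s t : 'rV[R]_3) : s *m t^T = 0 -> t *m s^T = 0.
  by move=> st; rewrite -[LHS]trmxK trmx_mul trmxK st trmx0.
have vu := tr0 _ _ uv; have wv := tr0 _ _ vw; have wu := tr0 _ _ uw.
exists P.
  apply/matrixP; do 2 apply: I3P; rewrite PE /f /= ?uu ?vv ?ww ?uv ?uw ?vw ?vu ?wu ?wv;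
    by rewrite !mxE.
apply/matrixP; do 2 apply: I3P; rewrite aE sym3E /f /= ?ua ?va ?wa -scalemxAl;
  by rewrite ?uu ?vv ?ww ?uv ?uw ?vw ?vu ?wu ?wv !mxE ?mulr1 ?mulr0.
Qed.

Lemma tr_sym3 (R : realType) (x11 x22 x33 x23 x13 x12 : R) :
  (sym3 x11 x22 x33 x23 x13 x12)^T = sym3 x11 x22 x33 x23 x13 x12.
Proof. by apply/matrixP; do 2 apply: I3P; rewrite mxE !sym3E. Qed.

Lemma sq_trace_sym (R : realType) (H : tensor4 R) :
  harmonic4 H -> (sq_trace H)^T = sq_trace H.
Proof. by move=> /harmP ->; rewrite sq_trace_harm tr_sym3. Qed.

Lemma cube_trace_sym (R : realType) (H : tensor4 R) :
  harmonic4 H -> (cube_trace H)^T = cube_trace H.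
Proof.
by move=> /harmP ->; rewrite cube_trace_harm sq_trace_harm contract_harm sym3_1 !sym3Z
  sym3D tr_sym3.
Qed.

Lemma triclinic_conj3 (R : realType) (g a b : 'M[R]_3) : orthogonal_group g ->
  triclinic a b -> triclinic (conj3 g a) (conj3 g b).
Proof.
move=> og tri [u [x [y [u0 /eigenspaceP ua /eigenspaceP ub]]]]; apply: tri.
have gg := orthogonal_groupV og.
have pull (m : 'M[R]_3) z : u *m conj3 g m = z *: u -> u *m g *m m = z *: (u *m g).
  rewrite /conj3 scalemxAl => <-.
  by rewrite -!mulmxA gg mulmx1.
exists (u *m g), x, y; split; try by apply/eigenspaceP; exact: pull.
apply: contra u0 => /eqP ug0.
by rewrite -[u]mulmx1 -og mulmxA ug0 mul0mx.
Qed.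

(** If two off-diagonal entries of [b] vanish, the coordinate axis of the index they share is a
    common eigenvector. *)
Lemma triclinic_two_nonzero (R : realType) (a1 a2 a3 b11 b22 b33 b23 b13 b12 : R) :
  triclinic (sym3 a1 a2 a3 0 0 0) (sym3 b11 b22 b33 b23 b13 b12) ->
  (b13 * b12) ^+ 2 + (b23 * b12) ^+ 2 + (b23 * b13) ^+ 2 != 0.
Proof.
move=> tri; apply/eqP => /sum_sqr_eq0[]; rewrite !mulf_eq0 => h1 h2 h3; apply: tri.
have mulE (i : 'I_3) (m : 'M[R]_3) : delta_mx 0 i *m m = row i m :> 'rV_3.
  by rewrite rowE.
have dE (i : 'I_3) : (delta_mx 0 i : 'rV[R]_3) != 0.
  by apply/rV0Pn; exists i; rewrite mxE !eqxx oner_eq0.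
have row_sym3 i (m : 'M[R]_3) z : (forall j, m i j = (i == j)%:R * z) ->
    ((delta_mx 0 i : 'rV[R]_3) <= eigenspace m z)%MS.
  move=> h; apply/eigenspaceP; rewrite mulE; apply/rowP => j.
  by rewrite !mxE h eqxx /= eq_sym mulrC.
have [z12|n12] := eqVneq b12 0; last first.
  move: h1 h2; rewrite !(negPf n12) !orbF => /eqP z13 /eqP z23.
  exists (delta_mx 0 o2), a3, b33; split=> //; apply: row_sym3; apply: I3P;
    by rewrite sym3E ?z13 ?z23 ?mul0r ?mul1r.
have [z13|n13] := eqVneq b13 0.
  exists (delta_mx 0 o0), a1, b11; split=> //; apply: row_sym3; apply: I3P;
    by rewrite sym3E ?z13 ?z12 ?mul0r ?mul1r.
move: h3; rewrite (negPf n13) orbF => /eqP z23.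
exists (delta_mx 0 o1), a2, b22; split=> //; apply: row_sym3; apply: I3P;
  by rewrite sym3E ?z23 ?z12 ?mul0r ?mul1r.
Qed.

(* Newton's identities: the power sums determine the cubic with roots [x', y', z']. *)
Lemma power_sums_root (R : numFieldType) (x y z x' y' z' : R) :
  x + y + z = x' + y' + z' ->
  x ^+ 2 + y ^+ 2 + z ^+ 2 = x' ^+ 2 + y' ^+ 2 + z' ^+ 2 ->
  x ^+ 3 + y ^+ 3 + z ^+ 3 = x' ^+ 3 + y' ^+ 3 + z' ^+ 3 ->
  [\/ x = x', x = y' | x = z'].
Proof.
move=> e1 e2 e3.
have : (x - x') * (x - y') * (x - z') = 0.
  transitivity (x ^+ 3 - (x' + y' + z') * x ^+ 2
    + ((x' + y' + z') ^+ 2 - (x' ^+ 2 + y' ^+ 2 + z' ^+ 2)) / 2 * x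
    - ((x' + y' + z') ^+ 3 - 3 * (x' + y' + z') * (x' ^+ 2 + y' ^+ 2 + z' ^+ 2)
       + 2 * (x' ^+ 3 + y' ^+ 3 + z' ^+ 3)) / 6); first by field.
  (* Written with the power sums of [x], [y], [z], the cubic has root [x]. *)
  by rewrite -e1 -e2 -e3; field.
move/eqP; rewrite !mulf_eq0 !subr_eq0 => /orP[/orP[]|] /eqP ->.
- by constructor 1.
- by constructor 2.
- by constructor 3.
Qed.

Lemma diagonal_power_sums (R : realType) (P a : 'M[R]_3) x y z :
  orthogonal_group P -> conj3 P a = sym3 x y z 0 0 0 ->
  [/\ \tr a = x + y + z, \tr (a ^+ 2) = x ^+ 2 + y ^+ 2 + z ^+ 2
    & \tr (a ^+ 3) = x ^+ 3 + y ^+ 3 + z ^+ 3].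
Proof.
move=> oP aE; rewrite [a ^+ 3]exprSr -(mxtrace_conj3 oP a) -(mxtrace_conj3 oP (a ^+ 2)).
rewrite -(mxtrace_conj3 oP (a ^+ 2 * a)) conj3M // conj3X // aE.
by rewrite sym3_sqr sym3_tr_mul !sym3_tr; split; ring.
Qed.

Lemma same_spectrum (R : realType) (a b : 'M[R]_3) x y z : a^T = a -> b^T = b ->
  x != y -> y != z -> x != z -> eigenvalue a x -> eigenvalue a y -> eigenvalue a z ->
  orthotropic b -> \tr a = \tr b -> \tr (a ^+ 2) = \tr (b ^+ 2) ->
  \tr (a ^+ 3) = \tr (b ^+ 3) -> eigenvalue b x.
Proof.
move=> sa sb xy yz xz ax ay az [x' [y' [z' [[xy' yz' xz'] [bx ey bz]]]]].
have [P oP aE] := diagonalize sa xy yz xz ax ay az.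
have [Q oQ bE] := diagonalize sb xy' yz' xz' bx ey bz.
have [-> -> ->] := diagonal_power_sums oP aE.
have [-> -> ->] := diagonal_power_sums oQ bE.
by move=> e1 e2 e3; have [->|->|->] := power_sums_root e1 e2 e3.
Qed.

(** * From equal invariants to the change of frame *)

Lemma d2E (R : realType) (E : tensor4 R) : d2 E = sq_trace (harmonic_part E).
Proof. by []. Qed.

Lemma d3E (R : realType) (E : tensor4 R) : d3 E = cube_trace (harmonic_part E).
Proof. by []. Qed.

Lemma invariants_d2 (R : realType) (E F : tensor4 R) :
  invariants E = invariants F -> [/\ \tr (d2 E) = \tr (d2 F),
    \tr (d2 E ^+ 2) = \tr (d2 F ^+ 2) & \tr (d2 E ^+ 3) = \tr (d2 F ^+ 3)].
Proof.
rewrite /invariants; move: (d2 E) (d3 E) (d2 F) (d3 F) => a b a' b' /(congr1 val) /=.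
by case.
Qed.

Lemma invariants_d3 (R : realType) (E F : tensor4 R) :
  invariants E = invariants F ->
  [/\ \tr (d3 E) = \tr (d3 F), \tr (d2 E * d3 E) = \tr (d2 F * d3 F)
   & \tr (d2 E ^+ 2 * d3 E) = \tr (d2 F ^+ 2 * d3 F)] /\
  [/\ \tr (d2 E * d3 E ^+ 2) = \tr (d2 F * d3 F ^+ 2),
     \tr (d2 E ^+ 2 * d3 E ^+ 2) = \tr (d2 F ^+ 2 * d3 F ^+ 2)
   & \tr (d3 E ^+ 3) = \tr (d3 F ^+ 3)].
Proof.
rewrite /invariants; move: (d2 E) (d3 E) (d2 F) (d3 F) => a b a' b' /(congr1 val) /=.
by case.
Qed.

Theorem theorem4p2 (R : realType) (E Ebar : tensor4 R)
  (hE : is_ela E) (hEbar : is_ela Ebar)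
  (tricE : triclinic (d2 E) (d3 E)) (orthE : orthotropic (d2 E))
  (tricEbar : triclinic (d2 Ebar) (d3 Ebar)) (orthEbar : orthotropic (d2 Ebar))
  (hinv : invariants E = invariants Ebar) :
  exists g : 'M[R]_3, orthogonal_group g /\ Ebar = tensor_act g E.
Proof.
have sym (F : tensor4 R) : is_ela F -> (d2 F)^T = d2 F /\ (d3 F)^T = d3 F.
  move=> /harmonic_part_harmonic hF.
  by split; [exact: sq_trace_sym | exact: cube_trace_sym].
have [x [y [z [[xy yz xz] [ex ey ez]]]]] := orthE.
have [P oP PE] := diagonalize (sym _ hE).1 xy yz xz ex ey ez.
have [Q oQ QE] : exists2 Q, orthogonal_group Q & conj3 Q (d2 Ebar) = sym3 x y z 0 0 0.
  have [t1 t2 t3] := invariants_d2 hinv.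
  have yx : y != x by rewrite eq_sym.
  have zx : z != x by rewrite eq_sym.
  have zy : z != y by rewrite eq_sym.
  have [sE sEbar] := ((sym _ hE).1, (sym _ hEbar).1).
  (* [same_spectrum] transfers the first listed eigenvalue only, so it is applied with each of the
     three in front. *)
  apply: (diagonalize sEbar xy yz xz).
  - exact: (same_spectrum sE sEbar xy yz xz ex ey ez orthEbar t1 t2 t3).
  - exact: (same_spectrum sE sEbar yx xz yz ey ex ez orthEbar t1 t2 t3).
  - exact: (same_spectrum sE sEbar zx xy zy ez ex ey orthEbar t1 t2 t3).
(* [F] and [G] must be opaque: unification diverges when it can unfold them. *)
have [F FE] : {F | F = tensor_act P E} by exists (tensor_act P E).
have [G GE] : {G | G = tensor_act Q Ebar} by exists (tensor_act Q Ebar).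
have hF : is_ela F by rewrite FE; exact: act_ela.
have hG : is_ela G by rewrite GE; exact: act_ela.
have aF : d2 F = sym3 x y z 0 0 0 by rewrite FE (d2_act oP hE).
have aG : d2 G = sym3 x y z 0 0 0 by rewrite GE (d2_act oQ hEbar).
have iFG : invariants F = invariants G.
  by rewrite FE GE (invariants_act oP hE) (invariants_act oQ hEbar).
have triG : triclinic (d2 G) (d3 G).
  by rewrite GE (d2_act oQ hEbar) (d3_act oQ hEbar); exact: triclinic_conj3 oQ tricEbar.
have [e1 [e2 [e3 [[s1 s2 s3] FG]]]] : exists e1 e2 e3,
    [/\ e1 ^+ 2 = 1, e2 ^+ 2 = 1 & e3 ^+ 2 = 1] /\
    d3 G = conj3 (sym3 e1 e2 e3 0 0 0) (d3 F).
  (* These relations supply the missing equality of the traces of [d_3^2]. *)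
  have sF := tr_cube_trace_sqr (harmonic_part_harmonic hF).
  have sG := tr_cube_trace_sqr (harmonic_part_harmonic hG).
  rewrite -d2E -d3E aF in sF; rewrite -d2E -d3E aG in sG.
  have := invariants_d3 iFG; rewrite aF aG => -[[t3 t5 t7] [t8 t10 t9]].
  rewrite t3 -sG in sF.
  move: (d3 F) (d3 G) (sym _ hF).2 (sym _ hG).2 t3 t5 t7 t8 t10 t9 sF.
  move=> b c /sym3P -> /sym3P -> t3 t5 t7 t8 t10 t9 sF.
  exact: (same_traces_conj xy yz xz t3 t5 t7 sF t8 t10 t9).
pose D := sym3 e1 e2 e3 0 0 0.
have oD : orthogonal_group D.
  rewrite /orthogonal_group /D tr_sym3 -[_ *m _]/(sym3 e1 e2 e3 0 0 0 ^+ 2).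
  by rewrite sym3_sqr sym3_1; congr sym3; rewrite ?(mulr0, mul0r, addr0, add0r) -?expr2.
(* The signs in [D] square to 1, so [D] preserves the diagonal [d_2] while matching [d_3];
   uniqueness in the frame applies. *)
have DFG : tensor_act D F = G.
  have aD : d2 (tensor_act D F) = sym3 x y z 0 0 0.
    by rewrite (d2_act oD hF) aF /D sym3_conj_diag s1 s2 s3 !mul1r !mulr0.
  have bD : d3 (tensor_act D F) = d3 G by rewrite (d3_act oD hF) FG.
  have iD : invariants (tensor_act D F) = invariants G by rewrite (invariants_act oD hF).
  have bG := sym3P (sym _ hG).2; rewrite aG bG in triG.
  apply: (ela_unique xy yz xz (triclinic_two_nonzero triG)
    (act_ela D hF) hG aD aG _ bG iD).
  by rewrite bD.
(* The identity [D P] acting on [E] equals [Q] acting on [Ebar], solved for [Ebar]. *)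
exists (Q^T *m (D *m P)); split.
  rewrite /orthogonal_group !trmx_mul trmxK.
  rewrite -!mulmxA [P *m _]mulmxA oP mul1mx [D *m _]mulmxA oD mul1mx.
  exact: orthogonal_groupV.
by rewrite -act_comp -act_comp -FE DFG GE act_comp (orthogonal_groupV oQ) act1.
Qed.
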